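(* Let $1\le p,q,r<\infty$ and let $\vartheta_1,\vartheta_2,\vartheta_3$ be Beurling weights on $\mathbb R^d$. If $\vartheta_3\prec\vartheta_1$ and $\frac{\vartheta_3(y)}{\vartheta_1(y)}$ does not tend to zero as $y\to\infty$ in $\mathbb R^d$, then the embedding $i:A^{p,1,q,r}_{\vartheta_1,\vartheta_2}(\mathbb R^d)\hookrightarrow A^{p,1,q,r}_{\vartheta_3,\vartheta_2}(\mathbb R^d)$ is never compact (i.e. the inclusion map is not a compact operator).
   Context: A Beurling weight on $\mathbb R^d$ is a measurable, locally integrable function $\vartheta:\mathbb R^d\to(0,\infty)$ with $\vartheta(x)\ge1$ and $\vartheta(x+y)\le\vartheta(x)\vartheta(y)$ for all $x,y$. $\vartheta\prec\vartheta'$ means there is $C>0$ with $\vartheta(x)\le C\vartheta'(x)$ for all $x$. For $1\le p,q<\infty$ and $\alpha\in\mathbb Z^d$ put $I_\alpha=\alpha+[0,1)^d$, $\|f\|_{pq}=\big(\sum_{\alpha\in\mathbb Z^d}\|f\|_{L^p(I_\alpha)}^q\big)^{1/q}$ (Lebesgue measure). $(L^p_\vartheta,\ell^q)$ is the space of $f\in L^p_{loc}(\mathbb R^d)$ (mod a.e. equality) with $\|f\|_{pq,\vartheta}:=\|f\vartheta\|_{pq}<\infty$. $\widehat f$ is the Fourier transform on $\mathbb R^d$, with $\widehat{\mathbb R^d}$ identified with $\mathbb R^d$. For Beurling weights $\vartheta,\omega$ on $\mathbb R^d$, $A^{p,1,q,r}_{\vartheta,\omega}(\mathbb R^d)=\{f\in(L^p_{\vartheta},\ell^1):\widehat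 f\in(L^q_{\omega},\ell^r)\}$ with norm $\|f\|^{p,1,q,r}_{\vartheta,\omega}=\|f\|_{p1,\vartheta}+\|\widehat f\|_{qr,\omega}$. *)

(* Defs.v *)
From HB Require Import structures.
From mathcomp Require Import all_boot all_order all_algebra complex.
From mathcomp Require Import all_classical all_reals all_analysis.

Set Implicit Arguments.
Unset Strict Implicit.
Unset Printing Implicit Defensive.
Import Order.TTheory GRing.Theory Num.Theory.
Import numFieldNormedType.Exports.

Local Open Scope classical_set_scope.
Local Open Scope ring_scope.
Local Open Scope complex_scope.

(* MathComp-Analysis equips tuples, but not row vectors, with the product
   sigma-algebra; over R it is the Borel sigma-algebra of R^n. *)
Section rV_measurable.
Context (R : realType) (n : nat).

Let coord (i : 'I_n) (x : 'rV[R]_n) : measurableTypeR R := x ord0 i.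

Let rV_set0 : g_sigma_preimage coord set0.
Proof. exact: sigma_algebra0. Qed.

Let rV_setC A : g_sigma_preimage coord A -> g_sigma_preimage coord (~` A).
Proof. exact: sigma_algebraC. Qed.

Let rV_bigcup (F : _^nat) : (forall i, g_sigma_preimage coord (F i)) ->
  g_sigma_preimage coord (\bigcup_i (F i)).
Proof. exact: sigma_algebra_bigcup. Qed.

HB.instance Definition _ := @isMeasurable.Build
  (measure_tuple_display default_measure_display)
  'rV[R]_n (g_sigma_preimage coord) rV_set0 rV_setC rV_bigcup.

Lemma measurable_coord (i : 'I_n) :
  measurable_fun [set: 'rV[R]_n] (fun x => x ord0 i).
Proof.
move=> _ Y mY; rewrite setTI; apply: sub_sigma_algebra => /=.
rewrite -bigcup_seq/=; exists i => /=; first by rewrite mem_index_enum.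
by exists Y => //; rewrite setTI.
Qed.

Lemma measurable_fun_rVP d (T : measurableType d) (f : T -> 'rV[R]_n) :
  (forall i, measurable_fun [set: T] (fun x => f x ord0 i)) ->
  measurable_fun [set: T] f.
Proof.
move=> mf _ A; rewrite setTI => mA.
suff: measurable `<=` [set A | measurable (f @^-1` A)] by exact.
apply: smallest_sub => [|{A mA}]; first split => /=.
- by rewrite preimage_set0.
- by move=> B mB; rewrite setTD preimage_setC; exact: measurableC.
- by move=> F mF; rewrite preimage_bigcup; exact: bigcup_measurable.
rewrite -bigcup_seq/= => B [i _ [C mC <-]] /=.
by rewrite setTI -[X in measurable X]setTI; exact: mf.
Qed.

End rV_measurable.

Section lebesgue_rV.
Context (R : realType).
Local Notation mR := (measurableTypeR R).
Local Notation sfmeasure n := {sigma_finite_measure set 'rV[R]_n -> \bar R}.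

Definition rV_cons n (z : mR * 'rV[R]_n) : 'rV[R]_n.+1 :=
  \row_i (if unlift ord0 i is Some j then z.2 ord0 j else z.1).

Definition rV_uncons n (x : 'rV[R]_n.+1) : mR * 'rV[R]_n :=
  (x ord0 ord0, \row_j x ord0 (lift ord0 j)).

Lemma rV_consK n : cancel (@rV_cons n) (@rV_uncons n).
Proof.
move=> [a v]; congr pair; first by rewrite mxE unlift_none.
by apply/rowP => j; rewrite !mxE liftK.
Qed.

Lemma measurable_rV_cons n : measurable_fun setT (@rV_cons n).
Proof.
apply: measurable_fun_rVP => i; case: (unliftP ord0 i) => [j|] ->.
- rewrite [X in measurable_fun _ X](_ : _ = (fun v : 'rV[R]_n => v ord0 j) \o snd).
    by apply: measurableT_comp => //; exact: measurable_coord.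
  by apply/funext => z; rewrite /= mxE liftK.
- rewrite [X in measurable_fun _ X](_ : _ = fst)//.
  by apply/funext => z; rewrite /= mxE unlift_none.
Qed.

Lemma measurable_rV_uncons n : measurable_fun setT (@rV_uncons n).
Proof.
apply/measurable_fun_pairP; split; first exact: measurable_coord.
apply: measurable_fun_rVP => i /=.
rewrite [X in measurable_fun _ X](_ : _ = fun x : 'rV[R]_n.+1 => x ord0 (lift ord0 i)).
  exact: measurable_coord.
by apply/funext => x; rewrite mxE.
Qed.

Section cons_measure.
Local Open Scope ereal_scope.
Context n (m : sfmeasure n).
Local Notation prod := (@lebesgue_measure R \x m).

Definition cons_measure : set 'rV[R]_n.+1 -> \bar R :=
  pushforward prod (@rV_cons n).

Let preim_cons (A : set 'rV[R]_n.+1) :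
  measurable A -> measurable (@rV_cons n @^-1` A).
Proof.
by move=> mA; rewrite -[X in measurable X]setTI; exact: measurable_rV_cons.
Qed.

Let cons_measure0 : cons_measure set0 = 0.
Proof. by rewrite /cons_measure /pushforward preimage_set0 measure0. Qed.

Let cons_measure_ge0 A : 0 <= cons_measure A.
Proof. by rewrite /cons_measure /pushforward measure_ge0. Qed.

Let cons_measure_sigma_additive : semi_sigma_additive cons_measure.
Proof.
move=> F mF tF mUF; rewrite /cons_measure /pushforward preimage_bigcup.
apply: measure_semi_sigma_additive.
- by move=> i; exact: preim_cons.
- apply/trivIsetP => /= i j _ _ ij; rewrite -preimage_setI.
  by move/trivIsetP : tF => /(_ _ _ _ _ ij) ->//; rewrite preimage_set0.
- by rewrite -preimage_bigcup; exact: preim_cons.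
Qed.

HB.instance Definition _ := isMeasure.Build _ _ _ cons_measure
  cons_measure0 cons_measure_ge0 cons_measure_sigma_additive.

Let cons_measure_sigma_finite : sigma_finite setT cons_measure.
Proof.
have /sigma_finiteP[E [UE ndE mE]] :=
  sigma_finiteT [the sigma_finite_measure _ _ of @lebesgue_measure R].
have /sigma_finiteP[G [UG ndG mG]] := sigma_finiteT m.
pose F k := E k `*` G k.
have UF : [set: mR * 'rV[R]_n] = \bigcup_k F k.
  rewrite -setXTT UE UG predeqE => -[x y]; split=> [[/= [i _ Ei] [j _ Gj]]|].
    exists (maxn i j) => //; split.
    - by move: x Ei; exact/subsetPset/ndE/leq_maxl.
    - by move: y Gj; exact/subsetPset/ndG/leq_maxr.
  by move=> [k _ [? ?]]; split; exists k.
have mF k : measurable (F k) /\ prod (F k) < +oo.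
  have [? ?] := mE k; have [? ?] := mG k.
  split; first exact: measurableX.
  by rewrite product_measure1E// lte_mul_pinfty// ge0_fin_numE.
exists (fun k => @rV_uncons n @^-1` F k).
  by rewrite -preimage_bigcup -UF preimage_setT.
move=> k; have [mFk Fk] := mF k; split.
  by rewrite -[X in measurable X]setTI; exact: measurable_rV_uncons.
rewrite /cons_measure /pushforward -comp_preimage.
by rewrite (_ : _ \o _ = id) ?preimage_id//; apply/funext => z; exact: rV_consK.
Qed.

HB.instance Definition _ := Measure_isSigmaFinite.Build _ _ _ cons_measure
  cons_measure_sigma_finite.

End cons_measure.

Fixpoint lebesgue_rV n : sfmeasure n :=
  if n is k.+1 then cons_measure (lebesgue_rV k)
  else \d_(0 : 'rV[R]_0).

(* Lebesgue measure on R^n is determined by its values on boxes. *)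
Lemma lebesgue_rV_box n (A : 'I_n -> set R) :
  (forall i, measurable (A i : set mR)) ->
  lebesgue_rV n [set x | forall i, A i (x ord0 i)] =
  (\prod_(i < n) lebesgue_measure (A i))%E.
Proof.
elim: n A => [A _|n IH A mA].
  rewrite big_ord0 /= diracE mem_set//; case=> //.
rewrite big_ord_recl -IH//=.
pose B := [set x : 'rV[R]_n | forall i, A (lift ord0 i) (x ord0 i)].
rewrite -/B.
have mB : measurable B.
  rewrite (_ : B = \bigcap_(i in [set: 'I_n])
     ((fun x : 'rV[R]_n => x ord0 i) @^-1` A (lift ord0 i))).
    apply: fin_bigcap_measurable => // i _.
    by rewrite -[X in measurable X]setTI; exact: (measurable_coord i measurableT (mA _)).
  by apply/seteqP; split=> x /= h i; [move=> _; exact: h|exact: (h i I)].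
rewrite -[RHS]product_measure1E// /cons_measure /pushforward.
congr product_measure1; apply/seteqP; split => -[a v] /=.
- move=> h; split => [|i]; first by have := h ord0; rewrite mxE unlift_none.
  by have := h (lift ord0 i); rewrite mxE liftK.
- move=> [ha hv] i; case: (unliftP ord0 i) => [j|] ->; rewrite mxE.
    by rewrite liftK.
  by rewrite unlift_none.
Qed.

End lebesgue_rV.

(* No measurability is needed: the integral of a nonnegative function is a
   supremum over the simple functions below it. *)
Lemma le_lower_integral dT (T : measurableType dT) (R : realType)
    (mu : {measure set T -> \bar R}) (f g : T -> \bar R) (C : R) : 0 < C ->
  (forall x, 0 <= f x)%E -> (forall x, 0 <= g x)%E ->
  (forall x, f x <= C%:E * g x)%E -> (\int[mu]_x f x <= C%:E * \int[mu]_x g x)%E.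
Proof.
move=> C0 f0 g0 fg; rewrite !ge0_integralTE//.
apply: ge_ereal_sup => _ [h /= hf <-].
have C1 : 0 <= C^-1 by rewrite invr_ge0 ltW.
rewrite -lee_pdivrMl// -sintegralrM.
apply: ereal_sup_ubound; exists (scale_nnsfun h C1) => // x /=.
by rewrite EFinM lee_pdivrMl// (le_trans (hf x)).
Qed.

Section spaces.
Context (R : realType) (d : nat).
Local Notation E := 'rV[R]_d.
Local Notation leb := (@lebesgue_rV R d).
Implicit Types (p q r : R) (w : E -> R) (f g : E -> R[i]).

(* Lebesgue measurability, i.e. measurability for the completed sigma-algebra;
   [measurable_fun] on ['rV[R]_d] alone is Borel measurability. The integral
   being a supremum over simple functions, the integral of a nonnegative
   Lebesgue measurable function is that of any a.e. equal Borel function. *)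
Definition lebesgue_measurable (h : E -> R) : Prop :=
  exists2 b : E -> R, measurable_fun setT b & {ae leb, forall x, h x = b x}.

Definition Lp_loc p f : Prop :=
  [/\ lebesgue_measurable (fun x => complex.Re (f x)),
      lebesgue_measurable (fun x => complex.Im (f x)) &
      forall K : set E, compact K ->
        (\int[leb]_(x in K) (Normc.normc (f x) `^ p)%:E < +oo)%E].

Definition beurling w : Prop :=
  [/\ Lp_loc 1 (fun x => (w x)%:C),
      forall x, 1 <= w x &
      forall x y, w (x + y) <= w x * w y].

Definition weight_prec w w' : Prop :=
  exists2 C : R, 0 < C & forall x, w x <= C * w' x.

Definition unit_cube (a : 'rV[int]_d) : set E :=
  [set x | forall i, (a ord0 i)%:~R <= x ord0 i < (a ord0 i)%:~R + 1].

Definition amalgam_norm p q (h : E -> R) : \bar R :=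
  ((\esum_(a in [set: 'rV[int]_d])
     'N[leb]_p%:E[EFin \o (h \_ (unit_cube a))] `^ q) `^ q^-1)%E.

Definition weighted_norm p q w f : \bar R :=
  amalgam_norm p q (fun x => Normc.normc (f x) * w x).

Definition weighted_amalgam p q w : set (E -> R[i]) :=
  [set f | Lp_loc p f /\ (weighted_norm p q w f < +oo)%E].

Definition cintegral f : R[i] :=
  (\int[leb]_x complex.Re (f x)) +i* (\int[leb]_x complex.Im (f x)).

(* Only meaningful for integrable [f]; every [f] in a weighted amalgam space
   with local exponent at least 1, global exponent 1 and a weight bounded
   below by 1 is integrable. *)
Definition fourier f (xi : E) : R[i] :=
  cintegral (fun x =>
    let t := 2 * pi * \sum_(i < d) x ord0 i * xi ord0 i in
    f x * (cos t -i* sin t)).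

Definition A_space p q r w1 w2 : set (E -> R[i]) :=
  [set f | weighted_amalgam p 1 w1 f /\ weighted_amalgam q r w2 (fourier f)].

Definition A_norm p q r w1 w2 f : \bar R :=
  (weighted_norm p 1 w1 f + weighted_norm q r w2 (fourier f))%E.

Definition at_infinity : set_system E :=
  [set A | exists M : R, forall y, M < `|y| -> A y].

Global Instance at_infinity_filter : Filter at_infinity.
Proof.
split; first by exists 0.
- move=> A B [M AM] [N BN]; exists (Num.max M N) => y.
  by rewrite gt_max => /andP[My Ny]; split; [exact: AM|exact: BN].
- by move=> A B AB [M AM]; exists M => y /AM /AB.
Qed.

Let le_amalgam_norm p q (h h' : E -> R) (C : R) : 1 <= p -> 1 <= q ->
  0 < C -> (forall x, `|h x| <= C * `|h' x|) ->
  (amalgam_norm p q h <= C%:E * amalgam_norm p q h')%E.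
Proof.
move=> p1 q1 C0 hh'.
have p0 : 0 < p by exact: lt_le_trans p1.
have q0 : 0 < q by exact: lt_le_trans q1.
have C0' : (0 <= C%:E)%E by rewrite lee_fin ltW.
have E0 (x : \bar R) : (0 <= x)%E -> x \in `[0%E, +oo%E].
  by move=> x0; rewrite in_itv/= x0 leey.
have CqK r : 0 < r -> ((C%:E `^ r) `^ r^-1 = C%:E)%E.
  by move=> r0; rewrite -poweRrM mulfV ?gt_eqF// poweRe1.
have le_Lnorm i : ('N[leb]_p%:E[EFin \o (h \_ (unit_cube i))] <=
    C%:E * 'N[leb]_p%:E[EFin \o (h' \_ (unit_cube i))])%E.
  rewrite unlock -[X in (X * _)%E](CqK p)// -poweRM ?poweR_ge0 ?integral_ge0//;
    last by move=> *; exact: poweR_ge0.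
  apply: gt0_ler_poweR; rewrite ?invr_ge0 ?(ltW p0) ?E0//.
  - by apply: integral_ge0 => *; exact: poweR_ge0.
  - by rewrite mule_ge0 ?poweR_ge0// integral_ge0// => *; exact: poweR_ge0.
  rewrite poweR_EFin; apply: le_lower_integral; first exact: powR_gt0.
  - by move=> x; exact: poweR_ge0.
  - by move=> x; exact: poweR_ge0.
  move=> x; rewrite -poweR_EFin -poweRM ?abse_ge0//.
  apply: gt0_ler_poweR; rewrite ?(ltW p0) ?E0 ?abse_ge0 ?mule_ge0 ?abse_ge0//.
  by rewrite /= /patch; case: ifP => _; rewrite lee_fin ?normr0 ?mulr0.
rewrite -[X in (X * _)%E](CqK q)// -poweRM ?poweR_ge0 ?esum_ge0//;
  last by move=> *; exact: poweR_ge0.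
apply: gt0_ler_poweR; rewrite ?invr_ge0 ?(ltW q0) ?E0//.
- by apply: esum_ge0 => *; exact: poweR_ge0.
- by rewrite mule_ge0 ?poweR_ge0// esum_ge0// => *; exact: poweR_ge0.
apply: ge_ereal_sup => _ [X [finX _] <-].
apply: (@le_trans _ _ (C%:E `^ q * \sum_(i \in X)
    'N[leb]_p%:E[EFin \o (h' \_ (unit_cube i))] `^ q)%E).
  rewrite ge0_mule_fsumr; last by move=> i; exact: poweR_ge0.
  apply: lee_fsum => // i _; rewrite -poweRM ?Lnorm_ge0//.
  by apply: gt0_ler_poweR; rewrite ?(ltW q0) ?E0 ?Lnorm_ge0 ?mule_ge0 ?Lnorm_ge0.
apply: lee_wpmul2l; first exact: poweR_ge0.
by apply: ereal_sup_ubound; exists X.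
Qed.

Lemma A_space_sub p q r w1 w2 w3 : 1 <= p ->
  beurling w1 -> beurling w3 -> weight_prec w3 w1 ->
  A_space p q r w1 w2 `<=` A_space p q r w3 w2.
Proof.
move=> p1 [_ w1_ge1 _] [_ w3_ge1 _] [C C0 w31] f [[fp fw] fF]; split=> //.
split=> //; apply: (@le_lt_trans _ _ (C%:E * weighted_norm p 1 w1 f)%E).
  apply: le_amalgam_norm => // x; rewrite !normrM.
  rewrite (ger0_norm (le_trans ler01 (w3_ge1 x))).
  rewrite (ger0_norm (le_trans ler01 (w1_ge1 x))) mulrCA.
  by apply: ler_wpM2l.
by apply: lte_mul_pinfty => //; rewrite lee_fin ltW.
Qed.

Definition A_incl p q r w1 w2 w3 (p1 : 1 <= p) (b1 : beurling w1)
    (b3 : beurling w3) (w31 : weight_prec w3 w1) :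
    A_space p q r w1 w2 -> A_space p q r w3 w2 :=
  fun u => SigSub (mem_set (A_space_sub p1 b1 b3 w31 (set_valP u))).

End spaces.

Arguments at_infinity : clear implicits.
Arguments A_incl {R d} p q r {w1} w2 {w3}.

(* Elements of a space of functions modulo a.e. equality are handled through
   representatives, [nX] and [nY] being seminorms that vanish exactly on the
   functions that are zero a.e.: a linear map is compact if every bounded
   sequence is sent to one having a norm-convergent subsequence. *)
Definition compact_operator (R : realType) (V W : zmodType)
    (X : set V) (Y : set W) (nX : V -> \bar R) (nY : W -> \bar R)
    (T : X -> Y) : Prop :=
  forall u : nat -> X, (exists M : R, forall n, (nX (val (u n)) <= M%:E)%E) ->
  exists2 k : nat -> nat, {homo k : m n / (m < n)%N} &
  exists g : Y, nY (val (T (u (k n))) - val g) @[n --> \oo] --> 0%E.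

(* Main.v *)
Require Import Defs.
From mathcomp Require Import all_boot all_order all_algebra complex.
From mathcomp Require Import all_classical all_reals all_analysis.
From mathcomp Require Import measurable_realfun finmap ring lra zify.

(** Translates of a fixed function to points that run to infinity are almost
disjointly supported, so no subsequence of them converges in norm; the weights
only have to be balanced against the translation.

The fixed function is the standard Gaussian.  A Beurling weight grows at most
exponentially ([beurling_exp_growth]), so the Gaussian and its Fourier
transform, which is again a Gaussian, lie in every weighted amalgam space.
Translating by a lattice point [a] multiplies the [w1]-norm by at most a
constant times [w1 a], by submultiplicativity, and only modulates the Fourier
transform.  Hence the translates divided by [w1 a] form a bounded family in the
source space ([normalized_packet_bounded]).

If [w3 / w1] does not tend to zero, it stays above some positive number along
pairwise distinct lattice points ([far_lattice_points]), and there the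
normalized translate times [w3] is at least some [2 * eta], with [eta]
independent of the point, on the whole unit cube at that point
([packet_cube_lower_bound]).

Suppose a subsequence of these translates converges to [g] in the target space.
The cube norms of [g] are summable, so they become small on the cubes of the
subsequence ([amalgam_small_cube]); the cube norms of the difference with [g]
become small by convergence.  Both cannot be small on the same cube: the
translate is bounded below there, so on at least half of the cube either [g] or
the difference is ([cube_dichotomy]).

Two ingredients need a proof of their own.  The local boundedness of a weight
comes from [w x <= w y * w (x - y)] and the fact that the set where [w] is small
fills most of a box, so that it meets its own reflections
([beurling_bounded_near0]).  The modulus of the Fourier transform of a
translated Gaussian on the line is obtained from the linear system of
differential equations satisfied by its real and imaginary parts
([gauss_transform_modulus]), and the case of several variables follows from
Fubini's theorem ([fourier_packet]).  Functions in the amalgam spaces and weights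
are only Lebesgue measurable, so their integrals are handled as lower integrals,
which are monotone without any measurability ([ge_lower_integral]). *)

Import Order.TTheory GRing.Theory Num.Theory.
Import numFieldNormedType.Exports.

Set Implicit Arguments.
Unset Strict Implicit.
Unset Printing Implicit Defensive.

Local Open Scope classical_set_scope.
Local Open Scope ring_scope.

(** * The Fourier transform of a Gaussian on the line *)

Section gaussian_line.
Context {R : realType}.
Local Notation mu := (@lebesgue_measure R).
Implicit Types (x y t : R).

(** The fundamental theorem of calculus on [-n, n], with dominated convergence.
This replaces integration by parts on the whole line. *)
Lemma Rintegral_derivative_eq0 (H h : R -> R) :
  (forall x, is_derive x 1 H (h x)) -> continuous h ->
  mu.-integrable setT (EFin \o h) ->
  H n%:R @[n --> \oo] --> 0 -> H (- n%:R) @[n --> \oo] --> 0 ->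
  \int[mu]_x h x = 0.
Proof.
move=> Hh ch ih Hp Hm.
pose I n := `[- n.+1%:R, n.+1%:R]%classic : set R.
have FTC n : (\int[mu]_(x in I n) (h x)%:E =
    (H n.+1%:R)%:E - (H (- n.+1%:R))%:E)%E.
  apply: continuous_FTC2.
  - by rewrite (@lt_trans _ _ 0)// ?oppr_lt0 ltr0n.
  - exact: continuous_subspaceT.
  - have cH : continuous H.
      move=> x; apply/differentiable_continuous/derivable1_diffP.
      exact: ex_derive.
    split.
    + by move=> x _; exact: ex_derive.
    + by apply: cvg_at_right_filter; exact: cH.
    + by apply: cvg_at_left_filter; exact: cH.
  - by move=> x _; rewrite derive1E; exact: derive_val.
have c1 : (\int[mu]_(x in I n) (h x)%:E)%E @[n --> \oo] -->
    (\int[mu]_x (h x)%:E)%E.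
  under eq_fun do rewrite integral_mkcond.
  apply: (@dominated_cvg _ _ _ mu setT _ _ _ (fun x => `|(h x)%:E|%E)) => //.
  - move=> n; apply/(measurable_restrictT (fun x => (h x)%:E)) => //.
      exact: measurable_itv.
    by apply: measurable_funTS; case/integrableP: ih.
  - move=> x _; apply: cvg_near_cst.
    exists (Num.trunc `|x|) => // n /= xn.
    rewrite patchE mem_set//= /I /= in_itv/= -ler_norml.
    by rewrite ltW// -truncn_le_nat.
  - by have := integrable_abse ih.
  - by move=> n x _; rewrite patchE; case: ifP => // _; rewrite abse0.
have c2 : (\int[mu]_(x in I n) (h x)%:E)%E @[n --> \oo] --> 0%E.
  under eq_fun do rewrite FTC -EFinB.
  apply: cvg_EFin; first exact: nearW.
  rewrite -[0]subr0; apply: cvgB => /=.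
  - by rewrite (cvg_shiftS (fun n => H n%:R)).
  - by rewrite (cvg_shiftS (fun n => H (- n%:R))).
have E : (\int[mu]_x (h x)%:E)%E = 0%E by exact: (cvg_unique _ c1 c2).
by rewrite /Rintegral E.
Qed.

Local Notation peak := (normal_peak 1 : R).
Local Notation g y := (normal_pdf y 1 : R -> R).

Lemma normal_pdf1E y x : g y x = peak * expR (- (x - y) ^+ 2 / 2).
Proof. by rewrite normal_pdfE ?oner_neq0// /normal_fun expr1n. Qed.

Lemma is_derive_normal_pdf1 y x : is_derive x 1 (g y) (- (x - y) * g y x).
Proof.
have -> : g y = (fun x => peak * expR (- (x - y) ^+ 2 / 2)).
  by apply/funext => ?; exact: normal_pdf1E.
rewrite /=.
have d1 : is_derive x 1 (fun x => - (x - y) ^+ 2 / 2 : R) (- (x - y)).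
  by apply: is_derive_eq; rewrite /GRing.scale/=; field.
have d2 := is_derive1_comp (is_derive_expR _) d1.
apply: is_derive_eq; rewrite /GRing.scale/=; ring.
Qed.

(** After [|x| <= |x - y| + |y|], the factor [|x - y|] is absorbed by half of the
Gaussian exponent, which leaves a Gaussian of variance 2. *)
Lemma integrable_normal_pdf_moment y :
  mu.-integrable setT (fun x => (`|x| * g y x)%:E).
Proof.
pose s : R := Num.sqrt 2.
have s2 : s ^+ 2 = 2 by rewrite sqr_sqrtr.
have s0 : s != 0 by rewrite sqrtr_eq0 -ltNge.
pose C := peak / normal_peak s.
have ib : mu.-integrable setT
    (fun x => (C * normal_pdf y s x + `|y| * g y x)%:E).
  under eq_fun do rewrite EFinD (EFinM C) (EFinM `|y|).
  apply: integrableD => //; apply: integrableZl => //;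
    exact: integrable_normal_pdf.
apply: le_integrable ib => //.
  apply/measurable_EFinP/measurable_funM => //.
  exact: measurable_normal_pdf.
move=> x _ /=; rewrite lee_fin normrM normr_id (ger0_norm (normal_pdf_ge0 y 1 x)).
have peak_gt0 u : u != 0 -> 0 < normal_peak u :> R.
  by move=> u0; exact: normal_peak_gt0.
have C0 : 0 < C by rewrite divr_gt0// peak_gt0// oner_neq0.
rewrite [leRHS]ger0_norm; last first.
  by rewrite ?addr_ge0 ?mulr_ge0 ?normal_pdf_ge0 ?invr_ge0 ?normal_peak_ge0.
have xy : `|x| <= `|x - y| + `|y| by rewrite -{1}(subrK y x) ler_normD.
apply: le_trans (ler_wpM2r (normal_pdf_ge0 y 1 x) xy) _.
rewrite mulrDl lerD2r normal_pdf1E (normal_pdfE _ s0) /normal_fun s2 /C.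
rewrite mulrCA -mulrA ler_wpM2l ?normal_peak_ge0// mulKf ?gt_eqF ?peak_gt0//.
have -> : - (x - y) ^+ 2 / 2 =
    - (x - y) ^+ 2 / (2 *+ 2) + - (x - y) ^+ 2 / (2 *+ 2) :> R.
  by field.
rewrite expRD mulrA ler_piMl ?expR_ge0//.
have -> : - (x - y) ^+ 2 / (2 *+ 2) = - (`|x - y| ^+ 2 / 4).
  by rewrite real_normK ?num_real//; field.
rewrite expRN ler_pdivrMr ?expR_gt0// mul1r; apply: le_trans (expR_ge1Dx _).
(* z <= 1 + z^2 / 4 *)
have := sqr_ge0 (`|x - y| / 2 - 1); set z := `|_|; nra.
Qed.

(** For [S] the cosine and the sine, the real part and minus the imaginary part of
the Fourier transform of the Gaussian centered at [y], at frequency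
[t / (2 * pi)]. *)
Definition gauss_transform (S : R -> R) y t := \int[mu]_x (g y x * S (x * t)).

Lemma integrable_gauss_mul (P : R -> R) y t :
    continuous P -> (forall x, `|P x| <= 1) ->
  mu.-integrable setT (fun x => (g y x * P (x * t))%:E).
Proof.
move=> cP P1; apply: (le_integrable _ _ _ (integrable_normal_pdf y 1)) => //.
- apply/measurable_EFinP/measurable_funM; first exact: measurable_normal_pdf.
  apply: (@measurableT_comp _ _ _ _ _ _ P).
    exact: continuous_measurable_fun.
  exact: measurable_funM.
- by move=> x _; rewrite lee_fin normrM ler_piMr.
Qed.

Lemma integrable_gauss_mul_moment (P : R -> R) y t :
    continuous P -> (forall x, `|P x| <= 1) ->
  mu.-integrable setT (fun x => (x * g y x * P (x * t))%:E).
Proof.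
move=> cP P1; apply: (le_integrable _ _ _ (integrable_normal_pdf_moment y)) => //.
- apply/measurable_EFinP/measurable_funM.
    by apply: measurable_funM => //; exact: measurable_normal_pdf.
  apply: (@measurableT_comp _ _ _ _ _ _ P).
    exact: continuous_measurable_fun.
  exact: measurable_funM.
- by move=> x _; rewrite lee_fin !normrM normr_id ler_piMr// mulr_ge0.
Qed.

Lemma cvg_normal_pdf1 y (P : R -> R) (u : nat -> R) : (forall n, `|u n| = n%:R) ->
  (forall x, `|P x| <= 1) -> g y (u n) * P (u n) @[n --> \oo] --> 0.
Proof.
move=> un P1; apply: norm_cvg0.
(* (u - y)^2 / 2 >= |u - y| - 1/2 >= |u| - |y| - 1/2 *)
pose D := peak * expR (`|y| + 2^-1).
have cD : D * expR (- n%:R) @[n --> \oo] --> 0.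
  by rewrite -[0](mulr0 D); apply: cvgMr; exact: cvgn_expR.
apply: squeeze_cvgr (cvg_cst 0) cD; apply: nearW => n.
rewrite normr_ge0/= normrM (ger0_norm (normal_pdf_ge0 _ _ _)).
apply: le_trans (ler_piMr (normal_pdf_ge0 _ _ _) (P1 _)) _.
rewrite normal_pdf1E /D -mulrA ler_wpM2l ?normal_peak_ge0// -expRD ler_expR.
have : `|u n| <= `|u n - y| + `|y| by rewrite -{1}(subrK y (u n)) ler_normD.
rewrite un -(real_normK (num_real (u n - y))).
by have := sqr_ge0 (`|u n - y| - 1); set z := `|_ - _|; nra.
Qed.

Section gauss_transform_derivative.
Variables (y : R) (S S' S'' : R -> R).
Hypothesis dS : forall x, is_derive x 1 S (S' x).
Hypothesis dS' : forall x, is_derive x 1 S' (S'' x).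
Hypothesis cS'' : continuous S''.
Hypothesis S1 : forall x, `|S x| <= 1.
Hypothesis S'1 : forall x, `|S' x| <= 1.
Hypothesis S''1 : forall x, `|S'' x| <= 1.

Let continuous_is_derive (F f : R -> R) :
  (forall x, is_derive x 1 F (f x)) -> continuous F.
Proof.
move=> dF x; apply/differentiable_continuous/derivable1_diffP.
exact: ex_derive.
Qed.

(** The derivative of [g y x * S' (x * t)] has integral zero.  As the Gaussian
satisfies [g' = - (x - y) g], this relation expresses the first moment by moments
of order zero. *)
Let int_moment t : \int[mu]_x (x * g y x * S' (x * t)) =
  y * gauss_transform S' y t + t * gauss_transform S'' y t.
Proof.
have cS' : continuous S' := continuous_is_derive dS'.
pose h x := - (x * g y x * S' (x * t)) +
  (y * (g y x * S' (x * t)) + t * (g y x * S'' (x * t))).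
have dH x : is_derive x 1 (fun x => g y x * S' (x * t)) (h x).
  have d1 := is_derive_normal_pdf1 y x.
  have d3 : is_derive x 1 (fun x => x * t : R) t.
    by apply: is_derive_eq; rewrite /GRing.scale/= mulr0 mulr1 add0r.
  have d2 := @is_derive1_comp _ S' (fun x => x * t) x _ _ (dS' (x * t)) d3.
  have := is_deriveM d1 d2 => /(@is_derive_eq _ _ _ _ _ _ _ _); apply.
  by rewrite /GRing.scale /h /=; ring.
have cg : continuous (g y) by exact: continuous_normal_pdf (oner_neq0 _).
have ch : continuous h.
  have cc (P : R -> R) : continuous P -> continuous (fun x => P (x * t)).
    move=> cP z.
    apply: (@continuous_comp _ _ _ (fun x => x * t) P); last exact: cP.
    by apply: cvgMl; exact: cvg_id.
  move=> z; apply: cvgD.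
    apply: cvgN; apply: cvgM; last exact: cc.
    by apply: cvgM; [exact: cvg_id|exact: cg].
  by apply: cvgD; apply: cvgMr; apply: cvgM; (exact: cg || exact: cc).
have i1 := integrable_gauss_mul_moment y t cS' S'1.
have i2 := integrable_gauss_mul y t cS' S'1.
have i3 := integrable_gauss_mul y t cS'' S''1.
have i23 : mu.-integrable setT
    (EFin \o (fun x => y * (g y x * S' (x * t)) + t * (g y x * S'' (x * t)))).
  rewrite /comp; under eq_fun do rewrite EFinD (EFinM y) (EFinM t).
  by apply: integrableD => //; exact: integrableZl.
have iN : mu.-integrable setT (EFin \o (fun x => - (x * g y x * S' (x * t)))).
  by rewrite /comp; under eq_fun do rewrite EFinN; exact: integrableN.
have ih : mu.-integrable setT (EFin \o h).
  by rewrite /comp; under eq_fun do rewrite EFinD; exact: integrableD.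
have : \int[mu]_x h x = 0.
  apply: Rintegral_derivative_eq0 dH ch ih _ _.
  - by apply: (@cvg_normal_pdf1 y (fun x => S' (x * t))) => // n; rewrite normr_nat.
  - apply: (@cvg_normal_pdf1 y (fun x => S' (x * t))) => // n.
    by rewrite normrN normr_nat.
rewrite RintegralD//; under eq_Rintegral do rewrite -mulN1r.
rewrite RintegralZl// RintegralD//; last 2 first.
  by rewrite /comp; under eq_fun do rewrite EFinM; exact: integrableZl.
  by rewrite /comp; under eq_fun do rewrite EFinM; exact: integrableZl.
rewrite !RintegralZl// mulN1r => /eqP; rewrite addrC subr_eq0 => /eqP.
exact: esym.
Qed.

(** Differentiation under the integral sign produces a first moment, which
integration by parts turns back into transforms of [S'] and [S'']: for the
cosine and the sine this closes into a linear system. *)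
Lemma is_derive_gauss_transform t : is_derive t 1 (gauss_transform S y)
  (y * gauss_transform S' y t + t * gauss_transform S'' y t).
Proof.
have cS : continuous S := continuous_is_derive dS.
have cS' : continuous S' := continuous_is_derive dS'.
pose f t x := g y x * S (x * t).
have df (u x : R) : is_derive u 1 (f ^~ x) (x * g y x * S' (x * u)).
  have d3 : is_derive u 1 (fun u => x * u : R) x.
    by apply: is_derive_eq; rewrite /GRing.scale/= mulr1.
  have d2 := @is_derive1_comp _ S (fun u => x * u) u _ _ (dS (x * u)) d3.
  have := is_deriveZ (g y x) d2 => /(@is_derive_eq _ _ _ _ _ _ _ _); apply.
  by rewrite /GRing.scale /=; ring.
have d1f u x : partial1of2 f u x = x * g y x * S' (x * u).
  by rewrite partial1of2E; exact: derive_val.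
have tI : `]t - 1, t + 1[%classic t by rewrite /= in_itv/=; apply/andP; split; lra.
have fi u : `]t - 1, t + 1[%classic u -> mu.-integrable setT (EFin \o f u).
  by move=> _; exact: integrable_gauss_mul.
have fd (u x : R) : `]t - 1, t + 1[%classic u -> [set: R] x ->
    derivable (f ^~ x) u 1.
  by move=> _ _; exact: ex_derive.
have G0 (x : R) : 0 <= `|x| * g y x by rewrite mulr_ge0// normal_pdf_ge0.
have Gub (u x : R) : `]t - 1, t + 1[%classic u -> [set: R] x ->
    `|partial1of2 f u x| <= `|x| * g y x.
  move=> _ _; rewrite d1f !normrM (ger0_norm (normal_pdf_ge0 _ _ _)).
  by rewrite ler_piMr.
have iG := integrable_normal_pdf_moment y.
split.
  exact: (derivable_under_integral measurableT tI fi fd G0 iG Gub).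
rewrite -int_moment -derive1E.
have -> := differentiation_under_integral measurableT tI fi fd G0 iG Gub.
by apply: eq_Rintegral => x _; exact: d1f.
Qed.

End gauss_transform_derivative.

Let derivN_cos (x : R) : is_derive x 1 (fun x => - cos x) (sin x).
Proof. by apply: is_derive_eq; rewrite opprK. Qed.

Let derivN_sin (x : R) : is_derive x 1 (fun x => - sin x) (- cos x).
Proof. by apply: is_derive_eq. Qed.

Let cos1 (x : R) : `|cos x| <= 1.
Proof. by rewrite ler_norml cos_geN1 cos_le1. Qed.

Let sin1 (x : R) : `|sin x| <= 1.
Proof. by rewrite ler_norml sin_geN1 sin_le1. Qed.

Let gauss_transformN (S : R -> R) y t : continuous S -> (forall x, `|S x| <= 1) ->
  gauss_transform (fun x => - S x) y t = - gauss_transform S y t.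
Proof.
move=> cS S1; rewrite /gauss_transform -mulN1r -RintegralZl//; last first.
  exact: integrable_gauss_mul.
by apply: eq_Rintegral => x _; ring.
Qed.

Lemma is_derive_gauss_transform_cos y t :
  is_derive t 1 (gauss_transform cos y)
    (- (y * gauss_transform sin y t + t * gauss_transform cos y t)).
Proof.
have := @is_derive_gauss_transform y cos
  (fun x => - sin x) (fun x => - cos x) _ _ _ _ _ _ t.
rewrite (gauss_transformN _ _ (@continuous_sin _) sin1).
rewrite (gauss_transformN _ _ (@continuous_cos _) cos1).
rewrite !mulrN -opprD; apply => //.
- by move=> x; apply: cvgN; exact: continuous_cos.
- by move=> x; rewrite normrN.
- by move=> x; rewrite normrN.
Qed.

Lemma is_derive_gauss_transform_sin y t :
  is_derive t 1 (gauss_transform sin y)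
    (y * gauss_transform cos y t - t * gauss_transform sin y t).
Proof.
have := @is_derive_gauss_transform y sin cos (fun x => - sin x) _ _ _ _ _ _ t.
rewrite (gauss_transformN _ _ (@continuous_sin _) sin1).
rewrite mulrN; apply => //.
- by move=> x; apply: cvgN; exact: continuous_sin.
- by move=> x; rewrite normrN.
Qed.

(** In the system for [c] and [s] the terms with the center [y] are a rotation, so
they cancel in the derivative of [c ^+ 2 + s ^+ 2], which is [- 2 * t] times itself.
The modulus therefore does not depend on [y], as it should since a translation
only modulates the Fourier transform. *)
Lemma gauss_transform_modulus y t :
  gauss_transform cos y t ^+ 2 + gauss_transform sin y t ^+ 2 = expR (- t ^+ 2).
Proof.
pose V t :=
  (gauss_transform cos y t ^+ 2 + gauss_transform sin y t ^+ 2) * expR (t ^+ 2).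
suff VE : V t = 1.
  have e0 : expR (t ^+ 2) != 0 by rewrite gt_eqF ?expR_gt0.
  by rewrite expRN -[LHS](mulfK e0) -/(V t) VE mul1r.
have dV (u : R) : is_derive u 1 V 0.
  have dc := is_derive_gauss_transform_cos y u.
  have ds := is_derive_gauss_transform_sin y u.
  have dq : is_derive u 1 (fun t => t ^+ 2 : R) (2 * u).
    by apply: is_derive_eq; rewrite /GRing.scale/=; ring.
  have de :=
    @is_derive1_comp _ expR (fun t => t ^+ 2) u _ _ (is_derive_expR _) dq.
  by apply: is_derive_eq; rewrite /GRing.scale/=; ring.
rewrite (is_derive_0_is_cst t 0 dV) /V expr0n expR0 mulr1.
have -> : gauss_transform sin y 0 = 0.
  rewrite /gauss_transform; under eq_Rintegral do rewrite mulr0 sin0 mulr0.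
  by rewrite /Rintegral integral0.
have -> : gauss_transform cos y 0 = 1.
  rewrite /gauss_transform; under eq_Rintegral do rewrite mulr0 cos0 mulr1.
  by rewrite /Rintegral integral_normal_pdf.
by rewrite expr0n addr0 expr1n.
Qed.

End gaussian_line.

(** * Tensor products and the Fourier transform of a Gaussian packet *)

Section tensor.
Local Open Scope complex_scope.
Context {R : realType}.
Local Notation mR := (measurableTypeR R).
Local Notation leb1 := (@lebesgue_measure R).

(** Lebesgue measure on the space of [n.+1] coordinates is by definition the image
under [rV_cons] of a product measure, so this is Fubini's theorem. *)
Lemma integrable_rV_cons n (f : mR -> R) (h : 'rV[R]_n -> R) :
    leb1.-integrable setT (EFin \o f) ->
    (lebesgue_rV R n).-integrable setT (EFin \o h) ->
  let fh x := f x.1 * h x.2 in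
  (lebesgue_rV R n.+1).-integrable setT (EFin \o (fh \o @rV_uncons R n)) /\
  \int[lebesgue_rV R n.+1]_x fh (rV_uncons x) =
  \int[leb1]_x f x * \int[lebesgue_rV R n]_x h x.
Proof.
move=> If Ih fh.
have [mf _] := integrableP _ _ _ If; have [mh _] := integrableP _ _ _ Ih.
have mfh : measurable_fun setT (EFin \o fh).
  apply/measurable_EFinP/measurable_funM.
    by apply: (@measurableT_comp _ _ _ _ _ _ f) => //; exact/measurable_EFinP.
  by apply: (@measurableT_comp _ _ _ _ _ _ h) => //; exact/measurable_EFinP.
have mfhu : measurable_fun setT (EFin \o (fh \o @rV_uncons R n)).
  by apply: (measurableT_comp mfh); exact: measurable_rV_uncons.
have I2 : (leb1 \x lebesgue_rV R n)%E.-integrable setT (EFin \o fh).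
  apply/integrable12ltyP => //.
  under eq_integral => x _.
    rewrite (_ : (\int[_]_y _)%E =
      (`|f x|%:E * \int[lebesgue_rV R n]_y `|(h y)%:E|)%E); last first.
      rewrite -integralZl//; last exact: integrable_abse Ih.
      by apply: eq_integral => y _; rewrite /= normrM EFinM.
    over.
  rewrite /=.
  have Ihf : (\int[lebesgue_rV R n]_x `|(h x)%:E| \is a fin_num)%E.
    exact: integrable_fin_num (integrable_abse Ih).
  rewrite -(fineK Ihf) integralZr//; last exact: integrable_abse If.
  apply: lte_mul_pinfty; rewrite ?integral_ge0//.
    exact: integrable_fin_num (integrable_abse If).
  exact: ltry.
pose fhu := fh \o @rV_uncons R n.
have fhK : fhu \o @rV_cons R n = fh.
  by apply/funext => z; rewrite /fhu /= rV_consK.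
split.
  apply: integrable_pushforward => //=; first exact: measurable_rV_cons.
  rewrite -[X in _.-integrable _ X]/(EFin \o (fhu \o @rV_cons R n)).
  by rewrite fhK preimage_setT.
have -> : \int[lebesgue_rV R n.+1]_x fh (rV_uncons x) =
    fine (\int[(leb1 \x lebesgue_rV R n)%E]_x (fh x)%:E)%E.
  congr fine.
  rewrite -[LHS]/(\int[pushforward (leb1 \x lebesgue_rV R n)%E (@rV_cons R n)]_x
    (EFin \o fhu) x)%E.
  rewrite integral_pushforward//; last 2 first.
  - exact: measurable_rV_cons.
  - rewrite -[X in _.-integrable _ X]/(EFin \o (fhu \o @rV_cons R n)).
    by rewrite fhK preimage_setT.
  rewrite preimage_setT.
  by rewrite -[X in integral _ _ X]/(EFin \o (fhu \o @rV_cons R n)) fhK.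
rewrite -(integral12_prod_meas1 I2) /fubini_F /=.
under eq_integral => x _.
  rewrite (_ : (\int[_]_y _)%E =
    ((f x)%:E * \int[lebesgue_rV R n]_y (h y)%:E)%E); last first.
    by rewrite -integralZl.
  over.
rewrite /=.
have Ihf : (\int[lebesgue_rV R n]_x (h x)%:E \is a fin_num)%E.
  exact: integrable_fin_num Ih.
have Iff : (\int[leb1]_x (f x)%:E \is a fin_num)%E.
  exact: integrable_fin_num If.
by rewrite -(fineK Ihf) integralZr// fineM.
Qed.

Section complex_integral.
Context d (T : measurableType d) (mu : {measure set T -> \bar R}).
Implicit Types f : T -> R[i].

Definition complex_integrable f : Prop :=
  mu.-integrable setT (EFin \o (@complex.Re R \o f)) /\
  mu.-integrable setT (EFin \o (@complex.Im R \o f)).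

(** [cintegral] for an arbitrary measure, so that the line and the space can be
treated alike. *)
Definition complex_integral f : R[i] :=
  (\int[mu]_x complex.Re (f x)) +i* (\int[mu]_x complex.Im (f x)).

Lemma complex_integralZl c f : complex_integrable f ->
  complex_integral (fun x => c%:C * f x) = c%:C * complex_integral f.
Proof.
move=> [fr fi]; rewrite /complex_integral; simpc; congr (_ +i* _).
  by rewrite -RintegralZl//; apply: eq_Rintegral => x _; case: (f x) => a b; simpc.
by rewrite -RintegralZl//; apply: eq_Rintegral => x _; case: (f x) => a b; simpc.
Qed.

End complex_integral.

Lemma integrable_linear d (T : measurableType d) (mu : {measure set T -> \bar R})
    (s : R) (u v : T -> R) :
    mu.-integrable setT (EFin \o u) -> mu.-integrable setT (EFin \o v) ->
  mu.-integrable setT (EFin \o (fun x => u x + s * v x)) /\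
  \int[mu]_x (u x + s * v x) = \int[mu]_x u x + s * \int[mu]_x v x.
Proof.
move=> iu iv.
have isv : mu.-integrable setT (EFin \o (fun x => s * v x)).
  by rewrite /comp; under eq_fun do rewrite EFinM; exact: integrableZl.
split; last by rewrite RintegralD// RintegralZl.
by rewrite /comp; under eq_fun do rewrite EFinD; exact: integrableD.
Qed.

(** Expanding the complex product leaves four real products, to each of which the
real case applies. *)
Lemma complex_integral_rV_cons n (f : mR -> R[i]) (h : 'rV[R]_n -> R[i]) :
    complex_integrable leb1 f -> complex_integrable (lebesgue_rV R n) h ->
  let fh x := f (rV_uncons x).1 * h (rV_uncons x).2 in
  complex_integrable (lebesgue_rV R n.+1) fh /\
  complex_integral (lebesgue_rV R n.+1) fh =
  complex_integral leb1 f * complex_integral (lebesgue_rV R n) h.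
Proof.
move=> [fr fi] [hr hi] fh.
have [irr Irr] := integrable_rV_cons fr hr.
have [iri Iri] := integrable_rV_cons fr hi.
have [iir Iir] := integrable_rV_cons fi hr.
have [iii Iii] := integrable_rV_cons fi hi.
have [ir Ir] := integrable_linear (-1) irr iii.
have [ii Ii] := integrable_linear 1 iri iir.
have reE : @complex.Re R \o fh = (fun x =>
    complex.Re (f (rV_uncons x).1) * complex.Re (h (rV_uncons x).2) + -1 *
    (complex.Im (f (rV_uncons x).1) * complex.Im (h (rV_uncons x).2))).
  apply/funext => x; rewrite /fh /=.
  by case: (f _) => a b; case: (h _) => a' b' /=; ring.
have imE : @complex.Im R \o fh = (fun x =>
    complex.Re (f (rV_uncons x).1) * complex.Im (h (rV_uncons x).2) + 1 *
    (complex.Im (f (rV_uncons x).1) * complex.Re (h (rV_uncons x).2))).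
  apply/funext => x; rewrite /fh /=.
  by case: (f _) => a b; case: (h _) => a' b' /=; ring.
split; first by split; [rewrite reE|rewrite imE].
rewrite /complex_integral -[X in X +i* _]/(\int[_]_x (@complex.Re R \o fh) x)
  -[X in _ +i* X]/(\int[_]_x (@complex.Im R \o fh) x) reE imE.
rewrite Ir Ii/= Irr Iri Iir Iii; simpc; congr (_ +i* _); rewrite /=; ring.
Qed.

Lemma complex_integral_prod n (F : 'I_n -> mR -> R[i]) :
    (forall i, complex_integrable leb1 (F i)) ->
  let f x := \prod_(i < n) F i (x ord0 i) in
  complex_integrable (lebesgue_rV R n) f /\
  complex_integral (lebesgue_rV R n) f =
  \prod_(i < n) complex_integral leb1 (F i).
Proof.
elim: n F => [F _|n IH F iF] /=.
  have m1 : lebesgue_rV R 0 setT = 1%E by rewrite [LHS]diracE mem_set.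
  have -> : (fun x : 'rV[R]_0 => \prod_(i < 0) F i (x ord0 i)) = cst 1.
    by apply/funext => x; rewrite big_ord0.
  have ic (k : R) : (lebesgue_rV R 0).-integrable setT (EFin \o cst k).
    apply/integrableP; split; first exact/measurable_EFinP.
    rewrite (_ : (\int[_]_x _)%E = (\int[lebesgue_rV R 0]_x (cst `|k|%:E x))%E)//.
    by rewrite integral_cst// [X in (_ * X)%E]m1 mule1 ltry.
  have Ic (k : R) : \int[lebesgue_rV R 0]_x k = k.
    by rewrite Rintegral_cst// [X in fine X]m1 mulr1.
  by rewrite big_ord0 /complex_integral Ic Ic; split=> //; split; exact: ic.
have [ih Ih] := IH (fun i => F (lift ord0 i)) (fun i => iF (lift ord0 i)).
have [] := complex_integral_rV_cons (iF ord0) ih.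
rewrite Ih big_ord_recl.
have -> : (fun x : 'rV[R]_n.+1 => F ord0 (rV_uncons x).1 *
    \prod_(i < n) F (lift ord0 i) ((rV_uncons x).2 ord0 i)) =
    (fun x => \prod_(i < n.+1) F i (x ord0 i)).
  apply/funext => x; rewrite big_ord_recl; congr (_ * _).
  by apply: eq_bigr => i _; rewrite mxE.
by [].
Qed.

Lemma cis_sum n (t : 'I_n -> R) :
  cos (\sum_i t i) -i* sin (\sum_i t i) = \prod_i (cos (t i) -i* sin (t i)).
Proof.
elim: n t => [|n IH] t; first by rewrite !big_ord0 cos0 sin0 oppr0.
rewrite !big_ord_recl -IH cosD sinD; simpc; congr (_ +i* _); ring.
Qed.

Definition gaussian_packet n (c : R) (a : 'rV[R]_n) (x : 'rV[R]_n) : R[i] :=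
  (c * \prod_i normal_pdf (a ord0 i) 1 (x ord0 i))%:C.

(** The integrand of the Fourier transform is a product of functions of one
coordinate each, as the exponential turns the scalar product into a product. *)
Lemma fourier_packet n c (a xi : 'rV[R]_n) :
  fourier (gaussian_packet c a) xi = c%:C *
    \prod_i (gauss_transform cos (a ord0 i) (2 * pi * xi ord0 i)
         -i* gauss_transform sin (a ord0 i) (2 * pi * xi ord0 i)).
Proof.
pose t i := 2 * pi * xi ord0 i.
pose F i (y : mR) : R[i] :=
  (normal_pdf (a ord0 i) 1 y)%:C * (cos (y * t i) -i* sin (y * t i)).
have ic i := integrable_gauss_mul (a ord0 i) (t i) (@continuous_cos R).
have is_ i := integrable_gauss_mul (a ord0 i) (t i) (@continuous_sin R).
have cos1 (x : R) : `|cos x| <= 1 by rewrite ler_norml cos_geN1 cos_le1.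
have sin1 (x : R) : `|sin x| <= 1 by rewrite ler_norml sin_geN1 sin_le1.
have reF i : @complex.Re R \o F i =
    fun x => normal_pdf (a ord0 i) 1 x * cos (x * t i).
  by apply/funext => y; rewrite /F/=; ring.
have imF i : @complex.Im R \o F i =
    fun x => - (normal_pdf (a ord0 i) 1 x * sin (x * t i)).
  by apply/funext => y; rewrite /F/=; ring.
have iF i : complex_integrable leb1 (F i).
  split; first by rewrite reF; exact: ic.
  by rewrite imF /comp; under eq_fun do rewrite EFinN; exact/integrableN/is_.
have [ip Ip] := complex_integral_prod iF.
have CF i : complex_integral leb1 (F i) =
    gauss_transform cos (a ord0 i) (t i) -i* gauss_transform sin (a ord0 i) (t i).
  rewrite /complex_integral -[X in X +i* _]/(\int[_]_x (@complex.Re R \o F i) x)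
    -[X in _ +i* X]/(\int[_]_x (@complex.Im R \o F i) x) reF imF.
  congr (_ +i* _); rewrite /gauss_transform -mulN1r -RintegralZl//; last first.
    exact: is_.
  by apply: eq_Rintegral => x _; rewrite mulN1r.
rewrite /fourier -[cintegral _]/(complex_integral (lebesgue_rV R n) _).
under [in RHS]eq_bigr do rewrite -CF.
rewrite -Ip -complex_integralZl//; congr (complex_integral _ _).
apply/funext => x.
rewrite (_ : 2 * pi * _ = \sum_i x ord0 i * t i); last first.
  by rewrite mulr_sumr; apply: eq_bigr => i _; rewrite /t; ring.
rewrite cis_sum /gaussian_packet rmorphM/= rmorph_prod -mulrA -big_split/=.
by [].
Qed.

End tensor.

(** * Lebesgue measure of boxes, reflections and lower integrals *)

Section reflection.
Context {R : realType}.
Local Notation mR := (measurableTypeR R).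
Local Notation leb1 := (@lebesgue_measure R).

Lemma coord_le_norm n (x : 'rV[R]_n) i : `|x ord0 i| <= `|x|.
Proof.
rewrite [leRHS]mx_normrE.
exact: (le_bigmax _ (fun ij : 'I_1 * 'I_n => `|x ij.1 ij.2|) (ord0, i)).
Qed.

Lemma norm_rV_le n (x : 'rV[R]_n) M :
  0 <= M -> (forall i, `|x ord0 i| <= M) -> `|x| <= M.
Proof.
move=> M0 xM; rewrite [leLHS]mx_normrE; apply: bigmax_le => // -[i j] _ /=.
by rewrite (ord1 i).
Qed.

Lemma measurable_fun_subl x : measurable_fun setT (fun a : mR => x - a : mR).
Proof. exact: measurable_funB. Qed.

Lemma lebesgue_measure_reflect x (A : set mR) : measurable A ->
  leb1 ((fun a => x - a) @^-1` A) = leb1 A.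
Proof.
pose f (a : mR) : mR := x - a.
have mf : measurable_fun setT f by exact: measurable_fun_subl.
pose m' := measure_function_pushforward__canonical__measure_function_Measure leb1 mf.
move=> mA; rewrite [RHS](@lebesgue_measure_unique _ m')// => _ [[a b]] _ <-.
rewrite [RHS](_ : _ = leb1 `[x - b, x - a[%classic); last first.
  congr (leb1 _); apply/seteqP; split => y /=;
    rewrite !in_itv/= /f/= => /andP[]; lra.
rewrite !lebesgue_measure_itv/= !lte_fin ltrD2l ltrN2.
by case: ifP => //; rewrite -!EFinB => _; congr EFin; ring.
Qed.

Lemma measurable_rV_subl n (x : 'rV[R]_n) :
  measurable_fun setT (fun v : 'rV[R]_n => x - v).
Proof.
apply: measurable_fun_rVP => i.
rewrite (_ : (fun _ => _) = fun v : 'rV[R]_n => x ord0 i - v ord0 i).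
  by apply: measurable_funB => //; exact: measurable_coord.
by apply/funext => v; rewrite !mxE.
Qed.

(** A point reflection acts coordinatewise, so induction on the dimension reduces
its invariance to the line, by uniqueness of the product measure. *)
Lemma lebesgue_rV_reflect n (x : 'rV[R]_n) (A : set 'rV[R]_n) : measurable A ->
  lebesgue_rV R n ((fun v : 'rV[R]_n => x - v) @^-1` A) = lebesgue_rV R n A.
Proof.
elim: n x A => [x A _|n IH x A mA].
  congr (lebesgue_rV R 0 _); apply/seteqP; split => y /=;
    by rewrite (thinmx0 (x - y)) (thinmx0 y).
pose rho (z : mR * 'rV[R]_n) : mR * 'rV[R]_n :=
  ((rV_uncons x).1 - z.1, (rV_uncons x).2 - z.2).
have mrho : measurable_fun setT rho.
  apply/measurable_fun_pairP; split => /=.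
    exact: (measurableT_comp (measurable_fun_subl _) measurable_fst).
  exact: (measurableT_comp (measurable_rV_subl _) measurable_snd).
rewrite /= /cons_measure /pushforward.
pose B := @rV_cons R n @^-1` A.
have mB : measurable B by rewrite -[B]setTI; exact: measurable_rV_cons.
rewrite [RHS](@product_measure_unique _ _ _ _ _ leb1 (lebesgue_rV R n)
  (measure_function_pushforward__canonical__measure_function_Measure
    (leb1 \x lebesgue_rV R n)%E mrho))//.
  have xE a v : rV_cons (rho (a, v)) = x - rV_cons (a, v).
    apply/rowP => i; rewrite !mxE; case: (unliftP ord0 i) => [j|] ->.
      by rewrite !mxE.
    by [].
  rewrite /pushforward; congr ((leb1 \x lebesgue_rV R n)%E _).
  apply/seteqP; split => -[a v] /=.
    by rewrite /B/= -xE.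
    by rewrite /B/= xE.
move=> A0 B0 mA0 mB0.
rewrite -[LHS]/((leb1 \x lebesgue_rV R n)%E (rho @^-1` (A0 `*` B0))).
rewrite (_ : rho @^-1` _ = ((fun a => (rV_uncons x).1 - a) @^-1` A0) `*`
   ((fun v => (rV_uncons x).2 - v) @^-1` B0))//.
rewrite product_measure1E ?lebesgue_measure_reflect ?IH//.
- by rewrite [X in (X * _)%E]lebesgue_measure_reflect.
- by rewrite -[X in measurable X]setTI; exact: measurable_fun_subl.
- by rewrite -[X in measurable X]setTI; exact: measurable_rV_subl.
Qed.

Lemma measurable_rV_box n (A : 'I_n -> set mR) : (forall i, measurable (A i)) ->
  measurable [set x : 'rV[R]_n | forall i, A i (x ord0 i)].
Proof.
move=> mA; rewrite (_ : [set _ | _] = \bigcap_(i in [set: 'I_n])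
   ((fun x : 'rV[R]_n => x ord0 i) @^-1` A i)).
  apply: fin_bigcap_measurable => // i _.
  rewrite -[X in measurable X]setTI.
  exact: (measurable_coord i measurableT (mA _)).
by apply/seteqP; split=> x /= h i; [move=> _; exact: h|exact: (h i I)].
Qed.

Definition centered_box n (r : R) : set 'rV[R]_n :=
  [set x | forall i, `[- r, r]%classic (x ord0 i)].

Lemma measurable_centered_box n r : measurable (@centered_box n r).
Proof.
apply: (@measurable_rV_box n (fun=> `[- r, r]%classic)) => i.
exact: measurable_itv.
Qed.

Lemma compact_centered_box n r : compact (@centered_box n r).
Proof.
exact: (@rV_compact R n (fun=> `[- r, r]%classic) (fun=> @segment_compact _ _ _)).
Qed.

Lemma lebesgue_centered_box n r : 0 < r ->
  lebesgue_rV R n (@centered_box n r) = ((2 * r) ^+ n)%:E.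
Proof.
move=> r0; rewrite (@lebesgue_rV_box R n (fun=> `[- r, r]%classic)); last first.
  by move=> i; exact: measurable_itv.
under eq_bigr do rewrite lebesgue_measure_itv/= lte_fin gt0_cp// -EFinB.
by rewrite prodEFin prodr_const card_ord; congr (_ ^+ _)%:E; ring.
Qed.

Lemma measurable_unit_cube n (a : 'rV[int]_n) : measurable (@unit_cube R n a).
Proof.
apply: (@measurable_rV_box n
  (fun i => [set y | (a ord0 i)%:~R <= y < (a ord0 i)%:~R + 1])) => i.
rewrite (_ : [set _ | _] = `[(a ord0 i)%:~R, (a ord0 i)%:~R + 1[%classic).
  exact: measurable_itv.
by apply/seteqP; split => y /=; rewrite in_itv.
Qed.

Lemma lebesgue_unit_cube n (a : 'rV[int]_n) :
  lebesgue_rV R n (@unit_cube R n a) = 1%E.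
Proof.
pose I i := `[(a ord0 i)%:~R : R, (a ord0 i)%:~R + 1[%classic.
have -> : @unit_cube R n a = [set x | forall i, I i (x ord0 i)].
  by apply/seteqP; split => x /= xa i; have := xa i; rewrite /I /= in_itv.
rewrite (@lebesgue_rV_box R n I); last by move=> i; exact: measurable_itv.
rewrite big1// => i _; rewrite lebesgue_measure_itv/= lte_fin ltrDl ltr01 -EFinB.
by congr EFin; ring.
Qed.

End reflection.

(** Chebyshev's inequality for a lower integral: the simple function equal to [c]
on [S] minus a null set, and to 0 elsewhere, lies below [f]. *)
Lemma ge_lower_integral dT (T : measurableType dT) (R : realType)
    (mu : {measure set T -> \bar R}) (S : set T) (c : R) (f : T -> \bar R) :
    measurable S -> 0 <= c -> (forall x, 0 <= f x)%E ->
    {ae mu, forall x, S x -> c%:E <= f x}%E ->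
  (c%:E * mu S <= \int[mu]_x f x)%E.
Proof.
move=> mS c0 f0 [N [mN N0 cf]].
have <- : (\int[mu]_x (c * \1_(S `\` N) x)%:E = c%:E * mu S)%E.
  under eq_integral do rewrite EFinM.
  rewrite ge0_integralZl//; last first.
    exact/measurable_EFinP/measurable_indic/measurableD.
  rewrite integral_indic// ?setIT; last exact: measurableD.
  congr (_ * _)%E; rewrite (measureDI mu mS mN).
  rewrite (subset_measure0 (measurableI _ _ mS mN) mN (@subIsetr _ S N) N0).
  by rewrite adde0.
rewrite -[leRHS]mul1e; apply: le_lower_integral => // x.
  by rewrite lee_fin mulr_ge0.
rewrite mul1e.
rewrite indicE; case: (boolP (x \in S `\` N)) => [|_]; last by rewrite mulr0.
move=> /set_mem[Sx nNx]; rewrite mulr1; apply: contrapT => h; apply: nNx.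
by apply: cf => /(_ Sx).
Qed.

(** * Exponential growth of Beurling weights *)

Section beurling_growth.
Context {R : realType} (n : nat).
Local Notation leb := (lebesgue_rV R n).
Implicit Types w : 'rV[R]_n -> R.

(** By Chebyshev's inequality the points of the box of radius 2 where [w] exceeds a
large [M] form a set [D] of less than half the measure of the box of radius 1.
For [x] in the unit ball, [D] and its reflection [x - D] then cannot cover the box
of radius 1, and a point [y] outside both gives [w x <= w y * w (x - y) <= M ^+ 2].
The set [D] also includes the null set [N] on which [w] may differ from a Borel
function. *)
Lemma beurling_bounded_near0 w : beurling w ->
  exists2 M : R, 1 <= M & forall x, `|x| <= 1 -> w x <= M.
Proof.
move=> [[[b mb [N [mN N0 wbN]]] _ wloc] w_ge1 wM].
have vE := @lebesgue_centered_box R n 1 ltr01.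
set v : R := (2 * 1) ^+ n in vE.
have v0 : 0 < v by rewrite exprn_gt0// mulr1.
pose I := (\int[leb]_(x in @centered_box R n 2) (w x)%:E)%E.
have w0 x : 0 <= w x by rewrite (le_trans ler01).
have I0 : (0 <= I)%E by apply: integral_ge0 => x _; rewrite lee_fin.
have If : I \is a fin_num.
  rewrite ge0_fin_numE//; apply: le_lt_trans (wloc _ (@compact_centered_box R n 2)).
  rewrite le_eqVlt; apply/orP; left; apply/eqP; apply: eq_integral => x _.
  by rewrite powRr1 /Normc.normc/= expr0n addr0 sqrtr_sqr ger0_norm.
pose M : R := 4 * (fine I + 1) / v.
have fI0 : 0 <= fine I by exact: fine_ge0.
have M0 : 0 < M by rewrite divr_gt0// mulr_gt0// ltr_wpDl.
pose D := @centered_box R n 2 `&` ([set x | M < b x] `|` N).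
have mbM : measurable [set x | M < b x].
  rewrite -[X in measurable X]setTI.
  rewrite (_ : [set x | M < b x] = b @^-1` `]M, +oo[%classic).
    by apply: mb => //; exact: measurable_itv.
  by apply/seteqP; split => x /=; rewrite in_itv/= andbT.
have mD : measurable D.
  by apply: measurableI; [exact: measurable_centered_box|exact: measurableU].
have MD : (M%:E * leb D <= I)%E.
  rewrite /I integral_mkcond; apply: ge_lower_integral => //; first exact: ltW.
    by move=> x; rewrite patchE; case: ifP => // _; rewrite lee_fin.
  exists N; split => // x /= /not_implyP[[xB [Mb|//]]] nle.
  apply: wbN => /= wb; apply: nle.
  by rewrite patchE mem_set// lee_fin wb ltW.
have leD : (leb D < (v / 2)%:E)%E.
  rewrite -(@lte_pmul2l _ M%:E)//; apply: le_lt_trans MD _.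
  rewrite -(fineK If) -EFinM lte_fin.
  have -> : M * (v / 2) = 2 * (fine I + 1) by rewrite /M; field; rewrite gt_eqF.
  lra.
have key x : `|x| <= 1 ->
    exists2 y, b y <= M /\ ~ N y & b (x - y) <= M /\ ~ N (x - y).
  move=> x1; apply: contrapT => nex.
  pose D' := (fun y : 'rV[R]_n => x - y) @^-1` D.
  have mD' : measurable D'.
    by rewrite -[X in measurable X]setTI; exact: measurable_rV_subl.
  have sub : @centered_box R n 1 `<=` D `|` D'.
    move=> y y1.
    have y2 : @centered_box R n 2 y.
      by move=> i; have := y1 i; rewrite /= !in_itv/= => /andP[]; lra.
    have xy2 : @centered_box R n 2 (x - y).
      move=> i; have := y1 i; have := le_trans (coord_le_norm x i) x1.
      by rewrite ler_norml /= !in_itv/= !mxE => /andP[? ?] /andP[]; lra.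
    apply: contrapT => nD; apply: nex; exists y; split.
    - by rewrite leNgt; apply/negP => h; apply: nD; left; split => //; left.
    - by move=> h; apply: nD; left; split => //; right.
    - by rewrite leNgt; apply/negP => h; apply: nD; right; split => //; left.
    - by move=> h; apply: nD; right; split => //; right.
  have : (leb (@centered_box R n 1) <= leb (D `|` D'))%E.
    apply: le_measure; rewrite ?in_setE//; last exact: measurableU.
    exact: measurable_centered_box.
  rewrite vE leNgt => /negP; apply.
  have ED : leb D' = leb D by exact: lebesgue_rV_reflect.
  apply: (@le_lt_trans _ _ (leb D + leb D)%E); last first.
    by rewrite [v]splitr EFinD lteD.
  by rewrite -[X in (_ <= _ + X)%E]ED; exact: measureU2.
exists (Num.max 1 (M ^+ 2)); first by rewrite le_max lexx.
move=> x /key[y [byM nNy] [bxyM nNxy]].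
have wb z : ~ N z -> w z = b z.
  by move=> nNz; apply: contrapT => h; apply: nNz; exact: wbN.
rewrite le_max; apply/orP; right; rewrite -{1}(subrK y x).
apply: le_trans (wM _ _) _; rewrite expr2 !wb//.
by apply: ler_pM; rewrite // -wb.
Qed.

(** A point of norm at most [m.+1] is a sum of [m.+1] points of the unit ball, so
the bound near the origin yields [w x <= M ^+ m.+1]. *)
Lemma beurling_exp_growth w : beurling w ->
  exists C k : R, [/\ 0 < C, 0 <= k &
    forall x, w x <= C * \prod_i expR (k * `|x ord0 i|)].
Proof.
move=> bw; have [M M1 wM1] := beurling_bounded_near0 bw.
have [_ w_ge1 wM] := bw.
have M0 : 0 < M by exact: lt_le_trans M1.
have w0 x : 0 <= w x by rewrite (le_trans ler01).
have wn (m : nat) x : `|x| <= m.+1%:R -> w x <= M ^+ m.+1.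
  elim: m x => [x|m IH x xm]; first by rewrite expr1; exact: wM1.
  have xE : x = m.+2%:R^-1 *: x + (1 - m.+2%:R^-1) *: x.
    by rewrite -scalerDl addrC subrK scale1r.
  have m0 : 0 < m.+2%:R :> R by rewrite ltr0n.
  rewrite xE; apply: le_trans (wM _ _) _; rewrite exprS; apply: ler_pM => //.
    by apply: wM1; rewrite normrZ gtr0_norm ?invr_gt0// ler_pdivrMl// mulr1.
  apply: IH; rewrite normrZ ger0_norm; last first.
    by rewrite subr_ge0 invf_le1// ler1n.
  have -> : (1 - m.+2%:R^-1) = m.+1%:R / m.+2%:R :> R.
    have -> : m.+1%:R = m.+2%:R - 1 :> R by rewrite -[m.+2%:R]natr1 addrK.
    by rewrite mulrBl divff ?gt_eqF// mul1r.
  by rewrite -mulrA ler_piMr// ler_pdivrMl// mulr1.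
exists M, (ln M); split => //; first exact: ln_ge0.
move=> x.
have -> : \prod_i expR (ln M * `|x ord0 i|) = expR (ln M * \sum_i `|x ord0 i|).
  by rewrite mulr_sumr expR_sum.
have nx : `|x| <= \sum_i `|x ord0 i|.
  apply: norm_rV_le; first exact: sumr_ge0.
  by move=> i; rewrite (bigD1 i)//= lerDl sumr_ge0.
have := truncn_itv (normr_ge0 x); set m := Num.trunc _ => /andP[mx xm].
apply: (le_trans (wn m x (ltW xm))); rewrite exprS ler_wpM2l ?(ltW M0)//.
rewrite -[M in leLHS]lnK ?posrE// -expRM_natl ler_expR.
rewrite mulrC ler_wpM2l ?ln_ge0//.
exact: le_trans nx.
Qed.

End beurling_growth.

(** * Sums over the integer lattice and amalgam norms *)

Section lattice_sum.
Context {R : realType}.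
Variable q : R.
Hypothesis q01 : 0 < q < 1.

Let q0 : 0 < q. Proof. by case/andP: q01. Qed.
Let q1 : q < 1. Proof. by case/andP: q01. Qed.

(** The bound is the sum of the two-sided geometric series. *)
Lemma sum_pow_dist N :
  \sum_(j < N.*2.+1) q ^+ `|j%:Z - N%:Z|%N <= (1 + q) / (1 - q).
Proof.
have q1' : 0 < 1 - q by rewrite subr_gt0.
(* Passing from N to N + 1 adds one term at each end of the range. *)
suff : (1 - q) * \sum_(j < N.*2.+1) q ^+ `|j%:Z - N%:Z|%N = 1 + q - 2 * q ^+ N.+1.
  move=> E; rewrite ler_pdivlMr// mulrC E gerBl.
  by rewrite mulr_ge0// exprn_ge0// ltW.
elim: N => [|N IH].
  by rewrite big_ord_recl big_ord0 /= expr0; ring.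
rewrite doubleS big_ord_recl big_ord_recr /=.
under eq_bigr => j _.
  rewrite (_ : `|_|%N = `|j%:Z - N%:Z|%N); last by rewrite /bump/=; lia.
  over.
rewrite subn0 /=.
rewrite (_ : `|_ - N.+1%:Z|%N = N.+1); last by rewrite /bump/=; lia.
by rewrite !mulrDr IH !exprS; ring.
Qed.

Definition lattice_decay n (a b : 'rV[int]_n) : R :=
  \prod_i q ^+ `|a ord0 i - b ord0 i|%N.

Lemma lattice_decay_ge0 n (a b : 'rV[int]_n) : 0 <= lattice_decay a b.
Proof. by apply: prodr_ge0 => i _; rewrite exprn_ge0// ltW. Qed.

Lemma lattice_decay_gt0 n (a b : 'rV[int]_n) : 0 < lattice_decay a b.
Proof. by apply: prodr_gt0 => i _; rewrite exprn_gt0. Qed.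

Lemma lattice_decay_le1 n (a b : 'rV[int]_n) : lattice_decay a b <= 1.
Proof.
by apply: prodr_ile1 => i; rewrite exprn_ge0 ?(ltW q0)// exprn_ile1// ltW.
Qed.

(** A finite set of lattice points lies in a cube around [b]; over such a cube the
sum of products factors into a product of one-dimensional sums.  The bound does
not depend on [b]. *)
Lemma esum_lattice_decay n (b : 'rV[int]_n) :
  (\esum_(a in [set: 'rV[int]_n]) (lattice_decay a b)%:E <=
   (((1 + q) / (1 - q)) ^+ n)%:E)%E.
Proof.
apply: ge_ereal_sup => _ [X [finX _] <-].
rewrite fsbig_finite//= sumEFin lee_fin.
set s := fset_set X.
pose N := (\sum_(a <- s) \sum_i `|a ord0 i - b ord0 i|)%N.
have sN a i : a \in s -> (`|a ord0 i - b ord0 i| <= N)%N.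
  move=> sa; rewrite /N (big_rem a)//= (bigD1 i)//=.
  by rewrite -addnA leq_addr.
pose phi (f : {ffun 'I_n -> 'I_N.*2.+1}) : 'rV[int]_n :=
  \row_i (b ord0 i + ((f i)%:Z - N%:Z)).
pose psi (a : 'rV[int]_n) : {ffun 'I_n -> 'I_N.*2.+1} :=
  [ffun i => inord `|a ord0 i - b ord0 i + N%:Z|].
(* phi enumerates the lattice cube of radius N around b. *)
have psiK a : a \in s -> phi (psi a) = a.
  move=> sa; apply/rowP => i; rewrite mxE ffunE inordK; have := sN _ i sa;
    move: (a ord0 i : int) (b ord0 i) {sN phi psi} N => u v k; lia.
apply: (@le_trans _ _ (\sum_f lattice_decay (phi f) b)).
  rewrite (eq_big_seq (fun a => lattice_decay (phi (psi a)) b)); last first.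
    by move=> a sa; rewrite psiK.
  rewrite -(big_map psi xpredT (fun f => lattice_decay (phi f) b)).
  have us : uniq (map psi s).
    rewrite map_inj_in_uniq ?fset_uniq// => a a' sa sa' e.
    by rewrite -(psiK _ sa) -(psiK _ sa') e.
  rewrite big_uniq//= [leRHS](bigID (fun f => f \in map psi s))/= lerDl.
  by apply: sumr_ge0 => f _; exact: lattice_decay_ge0.
rewrite /lattice_decay; under eq_bigr => f _.
  under eq_bigr => i _.
    rewrite mxE (_ : `|_|%N = `|(f i)%:Z - N%:Z|%N); last by congr absz; ring.
    over.
  over.
rewrite -(bigA_distr_bigA
  (fun (i : 'I_n) (j : 'I_N.*2.+1) => q ^+ `|j%:Z - N%:Z|%N)).
rewrite -[n in leRHS]card_ord -prodr_const; apply: ler_prod => i _.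
rewrite sum_pow_dist andbT; apply: sumr_ge0 => j _.
by rewrite exprn_ge0// ltW.
Qed.

End lattice_sum.

Section norm_bounds.
Context {R : realType} (n : nat).
Local Notation leb := (lebesgue_rV R n).
Implicit Types (h : 'rV[R]_n -> R).

Lemma poweR_le (x y : \bar R) (r : R) : 0 <= r -> (0 <= x)%E -> (x <= y)%E ->
  (x `^ r <= y `^ r)%E.
Proof.
move=> r0 x0 xy; apply: gt0_ler_poweR => //; rewrite in_itv/= leey andbT//.
exact: le_trans xy.
Qed.

Lemma Lnorm_cube_le p h a (M : R) : 1 <= p -> 0 < M ->
  (forall x, unit_cube a x -> `|h x| <= M) ->
  ('N[leb]_p%:E[EFin \o (h \_ (unit_cube a))] <= M%:E)%E.
Proof.
move=> p1 M0 hM; have p0 : 0 < p by exact: lt_le_trans p1.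
rewrite unlock.
have -> : M%:E = ((M `^ p)%:E `^ p^-1)%E.
  by rewrite poweR_EFin -powRrM mulfV ?gt_eqF// powRr1// ltW.
apply: poweR_le; first by rewrite invr_ge0 ltW.
  by apply: integral_ge0 => *; exact: poweR_ge0.
have -> : (M `^ p)%:E =
    ((M `^ p)%:E * \int[leb]_x (\1_(@unit_cube R n a) x)%:E)%E.
  rewrite integral_indic//; last exact: measurable_unit_cube.
  by rewrite setIT [X in (_ * X)%E]lebesgue_unit_cube mule1.
apply: le_lower_integral; first exact: powR_gt0.
- by move=> x; exact: poweR_ge0.
- by move=> x; rewrite lee_fin.
- move=> x; rewrite /= patchE indicE; case: ifP => xa.
    rewrite mule1 -!poweR_EFin; apply: poweR_le => //; first exact: ltW.
    by rewrite lee_fin hM// -in_setE.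
  by rewrite mule0 -[point]/(0 : R) normr0 powR0 ?gt_eqF.
Qed.

Lemma floor_dist (x b : R) (a c : int) : a%:~R <= x < a%:~R + 1 -> b = c%:~R ->
  expR (- `|x - b|) <= expR 1 * expR (- 1) ^+ `|a - c|%N.
Proof.
move=> /andP[ax xa] ->; rewrite -expRM_natl -expRD ler_expR.
have : `|a - c|%N%:R <= 1 + `|x - c%:~R|.
  rewrite natr_absz intr_norm rmorphB/=.
  have -> : a%:~R - c%:~R = (a%:~R - x) + (x - c%:~R) :> R by ring.
  apply: le_trans (ler_normD _ _) _; rewrite lerD2r ler_norml; lra.
lra.
Qed.

Let q : R := expR (- 1).
Let q01 : 0 < q < 1.
Proof. by rewrite expR_gt0 -[X in _ < X]expR0 ltr_expR oppr_lt0 ltr01. Qed.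

(** What matters is that [B] does not depend on the center [b]. *)
Lemma amalgam_norm_le p r C : 1 <= p -> 1 <= r -> 0 < C -> exists B : R,
  forall h (b : 'rV[int]_n),
  (forall x, `|h x| <= C * \prod_i expR (- `|x ord0 i - (b ord0 i)%:~R|)) ->
  (amalgam_norm p r h <= B%:E)%E.
Proof.
move=> p1 r1 C0.
have r0 : 0 < r by exact: lt_le_trans r1.
pose C1 := C * expR 1 ^+ n.
have C10 : 0 < C1 by rewrite mulr_gt0// exprn_gt0 ?expR_gt0.
pose S : R := ((1 + q) / (1 - q)) ^+ n.
exists ((C1 `^ r * S) `^ r^-1) => h b hC.
rewrite /amalgam_norm -poweR_EFin; apply: poweR_le; first by rewrite invr_ge0 ltW.
  by apply: esum_ge0 => *; exact: poweR_ge0.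
have Na a : ('N[leb]_p%:E[EFin \o (h \_ (unit_cube a))] <=
    (C1 * lattice_decay q a b)%:E)%E.
  apply: Lnorm_cube_le => //; first by rewrite mulr_gt0 ?lattice_decay_gt0.
  move=> x xa; apply: le_trans (hC x) _.
  rewrite /C1 -mulrA ler_wpM2l ?(ltW C0)//.
  rewrite -[n in expR 1 ^+ n]card_ord -prodr_const.
  rewrite /lattice_decay -big_split/=; apply: ler_prod => i _; rewrite expR_ge0/=.
  exact: floor_dist (xa i) erefl.
apply: (@le_trans _ _ (\esum_(a in [set: 'rV[int]_n])
    ((C1 `^ r)%:E * (lattice_decay q a b)%:E))%E).
  apply: le_esum => a _.
  apply: le_trans (poweR_le (ltW r0) (Lnorm_ge0 _ _ _) (Na a)) _.
  rewrite poweR_EFin -EFinM lee_fin powRM ?(ltW C10) ?lattice_decay_ge0//.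
  rewrite ler_wpM2l ?powR_ge0// ge1r_powR//.
  by rewrite lattice_decay_gt0// lattice_decay_le1.
apply: ge_ereal_sup => _ [X [finX _] <-].
rewrite -ge0_mule_fsumr; last by move=> a; rewrite lee_fin lattice_decay_ge0.
rewrite EFinM; apply: lee_wpmul2l; first by rewrite lee_fin powR_ge0.
apply: le_trans (esum_lattice_decay q01 b).
by apply: ereal_sup_ubound; exists X.
Qed.

(** The exponential growth of the weight is absorbed by the Gaussian, with an
exponential decay to spare. *)
Lemma beurling_gauss_le (w : 'rV[R]_n -> R) : beurling w ->
  exists2 C : R, 0 < C & forall x,
    w x * \prod_i expR (- x ord0 i ^+ 2 / 2) <= C * \prod_i expR (- `|x ord0 i|).
Proof.
move=> /beurling_exp_growth[C [k [C0 k0 wC]]].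
exists (C * expR ((k + 1) ^+ 2 / 2) ^+ n).
  by rewrite mulr_gt0// exprn_gt0 ?expR_gt0.
move=> x; apply: (le_trans (ler_wpM2r _ (wC x))).
  by apply: prodr_ge0 => i _; exact: expR_ge0.
rewrite -!mulrA ler_wpM2l ?(ltW C0)//.
rewrite -[n in expR _ ^+ n]card_ord -prodr_const -!big_split/=.
apply: ler_prod => i _; rewrite mulr_ge0 ?expR_ge0//= -!expRD ler_expR.
rewrite -(real_normK (num_real (x ord0 i))); set z := `|_|.
(* (k + 1) z <= z^2 / 2 + (k + 1)^2 / 2 *)
have := sqr_ge0 (z - (k + 1)); nra.
Qed.

End norm_bounds.

(** * Gaussian packets *)

Section packets.
Local Open Scope complex_scope.
Context {R : realType} (n : nat).
Local Notation leb := (lebesgue_rV R n).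
Local Notation E := 'rV[R]_n.
Implicit Types (f : E -> R[i]) (w : E -> R).

Lemma normc_real (x : R) : Normc.normc x%:C = `|x|.
Proof. by rewrite /Normc.normc/= expr0n addr0 sqrtr_sqr. Qed.

Lemma normc_ge0 (z : R[i]) : 0 <= Normc.normc z.
Proof. by case: z => a b; exact: sqrtr_ge0. Qed.

Definition complex_measurable f : Prop :=
  measurable_fun setT (fun x => complex.Re (f x)) /\
  measurable_fun setT (fun x => complex.Im (f x)).

Lemma complex_measurableM f g : complex_measurable f -> complex_measurable g ->
  complex_measurable (fun x => f x * g x).
Proof.
move=> [fr fi] [gr gi]; split.
  rewrite (_ : (fun x => complex.Re _) = fun x =>
    complex.Re (f x) * complex.Re (g x) - complex.Im (f x) * complex.Im (g x)).
    by apply: measurable_funB; exact: measurable_funM.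
  by apply/funext => x; case: (f x) => a b; case: (g x).
rewrite (_ : (fun x => complex.Im _) = fun x =>
  complex.Re (f x) * complex.Im (g x) + complex.Im (f x) * complex.Re (g x)).
  by apply: measurable_funD; exact: measurable_funM.
by apply/funext => x; case: (f x) => a b; case: (g x).
Qed.

Lemma complex_measurable_cst c : complex_measurable (fun=> c).
Proof. by split; exact: measurable_cst. Qed.

Lemma complex_measurable_prod (I : Type) (s : seq I) (F : I -> E -> R[i]) :
  (forall i, complex_measurable (F i)) ->
  complex_measurable (fun x => \prod_(i <- s) F i x).
Proof.
move=> mF; elim: s => [|i s IH].
  by under eq_fun do rewrite big_nil; exact: complex_measurable_cst.
by under eq_fun do rewrite big_cons; exact: complex_measurableM.
Qed.

Lemma complex_measurable_lebesgue f : complex_measurable f ->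
  lebesgue_measurable (fun x => complex.Re (f x)) /\
  lebesgue_measurable (fun x => complex.Im (f x)).
Proof.
move=> [fr fi]; split.
- by exists (fun x => complex.Re (f x)) => //; exact: aeW.
- by exists (fun x => complex.Im (f x)) => //; exact: aeW.
Qed.

(** A compact set lies in a box, which has finite measure. *)
Lemma Lp_loc_bounded p f (M : R) : 0 < p -> 0 < M -> complex_measurable f ->
  (forall x, Normc.normc (f x) <= M) -> Lp_loc p f.
Proof.
move=> p0 M0 /complex_measurable_lebesgue[fr fi] fM; split => // K cK.
have [r r0 Kr] : exists2 r, 0 < r & K `<=` @centered_box R n r.
  have [r [_ Kr]] := compact_bounded cK.
  exists (`|r| + 1); first by rewrite ltr_wpDl.
  have r1 : r < `|r| + 1 by rewrite (le_lt_trans (ler_norm r))// ltrDl.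
  move=> x /(Kr _ r1) /= xr i.
  by rewrite /= in_itv/= -ler_norml (le_trans (coord_le_norm x i)).
have p0' := ltW p0.
apply: (@le_lt_trans _ _
    ((M `^ p)%:E * \int[leb]_x (\1_(@centered_box R n r) x)%:E)%E); last first.
  rewrite integral_indic//; last exact: measurable_centered_box.
  by rewrite setIT [X in (_ * X)%E]lebesgue_centered_box// -EFinM ltry.
rewrite integral_mkcond; apply: le_lower_integral; first exact: powR_gt0.
- by move=> x; rewrite patchE; case: ifP => // _; rewrite lee_fin powR_ge0.
- by move=> x; rewrite lee_fin.
move=> x; rewrite patchE; case: ifPn => [xK|_].
  have xr := Kr _ (set_mem xK); rewrite indicE mem_set// mule1 lee_fin.
  by apply: ge0_ler_powR => //; rewrite nnegrE ?(ltW M0)// normc_ge0.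
by rewrite mule_ge0// lee_fin ?powR_ge0.
Qed.

Lemma measurable_gauss_transform (S : R -> R) (y : R) :
  (forall t, derivable (gauss_transform S y) t 1) ->
  measurable_fun setT (gauss_transform S y).
Proof.
move=> dS; apply: continuous_measurable_fun => t.
by apply/differentiable_continuous/derivable1_diffP.
Qed.

Lemma complex_measurable_packet c (a : E) : complex_measurable (gaussian_packet c a).
Proof.
split; last exact: measurable_cst.
rewrite (_ : (fun x => _) =
  fun x : E => c * \prod_i normal_pdf (a ord0 i) 1 (x ord0 i))//.
apply: measurable_funM => //; apply: measurable_prod => i _.
by apply: (measurableT_comp (measurable_normal_pdf _ _)); exact: measurable_coord.
Qed.

Lemma complex_measurable_fourier_packet c (a : E) :
  complex_measurable (fourier (gaussian_packet c a)).
Proof.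
rewrite (_ : fourier _ = fun xi => c%:C *
    \prod_i (gauss_transform cos (a ord0 i) (2 * pi * xi ord0 i)
         -i* gauss_transform sin (a ord0 i) (2 * pi * xi ord0 i))); last first.
  by apply/funext => xi; exact: fourier_packet.
apply: complex_measurableM; first exact: complex_measurable_cst.
apply: complex_measurable_prod => i.
have mt : measurable_fun setT (fun xi : E => 2 * pi * xi ord0 i).
  by apply: measurable_funM => //; exact: measurable_coord.
split => /=.
  apply: (measurableT_comp (measurable_gauss_transform _) mt) => t.
  by have [] := is_derive_gauss_transform_cos (a ord0 i) t.
apply: measurableT_comp => //.
apply: (measurableT_comp (measurable_gauss_transform _) mt) => t.
by have [] := is_derive_gauss_transform_sin (a ord0 i) t.
Qed.

Lemma normc_prod (I : Type) (s : seq I) (F : I -> R[i]) :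
  Normc.normc (\prod_(i <- s) F i) = \prod_(i <- s) Normc.normc (F i).
Proof. exact: (big_morph _ (@Normc.normcM R) (@Normc.normc1 R)). Qed.

Lemma normc_packet c (a : E) x : 0 <= c -> Normc.normc (gaussian_packet c a x) =
  c * (normal_peak 1 ^+ n * \prod_i expR (- (x - a) ord0 i ^+ 2 / 2)).
Proof.
move=> c0; rewrite normc_real ger0_norm; last first.
  by rewrite mulr_ge0// prodr_ge0// => i _; exact: normal_pdf_ge0.
congr (_ * _); rewrite -[n in _ ^+ n]card_ord -prodr_const -big_split/=.
by apply: eq_bigr => i _; rewrite normal_pdf1E !mxE.
Qed.

(** The true exponent is [- 2 * pi ^+ 2 * xi ^+ 2]; the weaker one has the same form as
for the packet itself, so that one estimate serves both sides. *)
Lemma normc_fourier_packet c (a xi : E) : 0 <= c ->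
  Normc.normc (fourier (gaussian_packet c a) xi) <=
  c * \prod_i expR (- xi ord0 i ^+ 2 / 2).
Proof.
move=> c0; rewrite fourier_packet Normc.normcM normc_real ger0_norm// normc_prod.
rewrite ler_wpM2l//; apply: ler_prod => i _; rewrite /Normc.normc/= sqrtr_ge0/=.
rewrite sqrrN gauss_transform_modulus -[leRHS]ger0_norm ?expR_ge0//.
rewrite -sqrtr_sqr ler_wsqrtr//.
rewrite -expRM_natl ler_expR.
have := pi_ge2 R; set P := pi; set z := xi _ _ => P2.
have : 1 <= (2 * P) ^+ 2 by rewrite expr2; nra.
rewrite exprMn => P1; have := sqr_ge0 z; nra.
Qed.

End packets.

(** * Uniform bounds for packets normalized by the weight *)

Section normalized_packets.
Local Open Scope complex_scope.
Context {R : realType} (n : nat).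
Local Notation leb := (lebesgue_rV R n).
Local Notation E := 'rV[R]_n.
Implicit Types (f : E -> R[i]) (w : E -> R) (b : 'rV[int]_n).

Definition lattice_point b : E := \row_i (b ord0 i)%:~R.

Definition normalized_packet w b : E -> R[i] :=
  gaussian_packet (w (lattice_point b))^-1 (lattice_point b).

Lemma beurling_gt0 w x : beurling w -> 0 < w x.
Proof. by move=> [_ w1 _]; apply: lt_le_trans (w1 x). Qed.

Lemma beurling_inv01 w x : beurling w -> 0 < (w x)^-1 <= 1.
Proof.
move=> bw; rewrite invr_gt0 beurling_gt0//= invf_le1 ?beurling_gt0//.
by case: bw.
Qed.

(** Submultiplicativity gives [w x / w a <= w (x - a)], so that the weighted packet
at [a] is dominated by the translate to [a] of the weighted packet at 0. *)
Lemma normalized_packet_time_bound p w : 1 <= p -> beurling w ->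
  exists B : R, forall b, (weighted_norm p 1 w (normalized_packet w b) <= B%:E)%E.
Proof.
move=> p1 bw; have [C C0 wC] := beurling_gauss_le bw.
pose P : R := normal_peak 1 ^+ n.
have P0 : 0 < P by rewrite exprn_gt0// normal_peak_gt0// oner_neq0.
have [B hB] := @amalgam_norm_le R n p 1 (P * C) p1 (lexx _) (mulr_gt0 P0 C0).
exists B => b; apply: (hB _ b) => x; set a := lattice_point b.
have wx := beurling_gt0 x bw; have wa := beurling_gt0 a bw.
rewrite normrM (ger0_norm (normc_ge0 _)) (gtr0_norm wx).
rewrite normc_packet; last by rewrite invr_ge0 ltW.
have wxa : w x <= w a * w (x - a).
  by case: bw => _ _ wM; rewrite -{1}(subrKC a x).
have G0 : 0 <= \prod_i expR (- (x - a) ord0 i ^+ 2 / 2).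
  by apply: prodr_ge0 => i _; exact: expR_ge0.
apply: (@le_trans _ _
    (P * (w (x - a) * \prod_i expR (- (x - a) ord0 i ^+ 2 / 2)))).
  rewrite -/a -/P; set G := \prod_i _ in G0 *.
  rewrite (_ : _ * _ * _ = P * ((w a)^-1 * w x * G)); last by ring.
  by rewrite ler_wpM2l ?(ltW P0)// ler_wpM2r// ler_pdivrMl.
rewrite -mulrA ler_wpM2l ?(ltW P0)//; apply: le_trans (wC _) _.
rewrite ler_wpM2l ?(ltW C0)//.
by apply: ler_prod => i _; rewrite expR_ge0/= !mxE.
Qed.

(** The bound on the Fourier transform of a packet does not see its center, and the
factor [(w a)^-1] is at most 1. *)
Lemma normalized_packet_frequency_bound q r w w' :
    1 <= q -> 1 <= r -> beurling w -> beurling w' ->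
  exists B : R, forall b,
    (weighted_norm q r w' (fourier (normalized_packet w b)) <= B%:E)%E.
Proof.
move=> q1 r1 bw bw'; have [C C0 wC] := beurling_gauss_le bw'.
have [B hB] := @amalgam_norm_le R n q r C q1 r1 C0.
exists B => b; apply: (hB _ 0) => x; set a := lattice_point b.
have /andP[c0 c1] := beurling_inv01 a bw.
have wx := beurling_gt0 x bw'.
rewrite normrM (ger0_norm (normc_ge0 _)) (gtr0_norm wx).
apply: (@le_trans _ _ (w' x * \prod_i expR (- x ord0 i ^+ 2 / 2))).
  rewrite mulrC ler_wpM2l ?(ltW wx)//.
  apply: le_trans (normc_fourier_packet _ _ (ltW c0)) _.
  by rewrite ler_piMl// prodr_ge0// => i _; exact: expR_ge0.
apply: le_trans (wC _) _; rewrite ler_wpM2l ?(ltW C0)//.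
by apply: ler_prod => i _; rewrite expR_ge0/= !mxE subr0.
Qed.

Lemma normalized_packet_Lp_loc p w b : 1 <= p -> beurling w ->
  Lp_loc p (normalized_packet w b).
Proof.
move=> p1 bw; have p0 : 0 < p by exact: lt_le_trans p1.
have /andP[c0 c1] := beurling_inv01 (lattice_point b) bw.
pose P : R := normal_peak 1 ^+ n.
have P0 : 0 < P by rewrite exprn_gt0// normal_peak_gt0// oner_neq0.
apply: (Lp_loc_bounded p0 P0); first exact: complex_measurable_packet.
move=> x; rewrite normc_packet ?(ltW c0)//.
rewrite mulrC -mulrA ler_piMr ?(ltW P0)// mulr_ile1 ?(ltW c0)//.
  by rewrite prodr_ge0// => i _; exact: expR_ge0.
apply: prodr_ile1 => i; rewrite expR_ge0/= -[leRHS]expR0 ler_expR.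
by rewrite mulNr oppr_le0 divr_ge0// sqr_ge0.
Qed.

Lemma fourier_normalized_packet_Lp_loc q w b : 1 <= q -> beurling w ->
  Lp_loc q (fourier (normalized_packet w b)).
Proof.
move=> q1 bw; have q0 : 0 < q by exact: lt_le_trans q1.
have /andP[c0 c1] := beurling_inv01 (lattice_point b) bw.
apply: (Lp_loc_bounded q0 ltr01); first exact: complex_measurable_fourier_packet.
move=> x; apply: le_trans (normc_fourier_packet _ _ (ltW c0)) _.
rewrite mulr_ile1 ?(ltW c0)//.
  by rewrite prodr_ge0// => i _; exact: expR_ge0.
apply: prodr_ile1 => i; rewrite expR_ge0/= -[leRHS]expR0 ler_expR.
by rewrite mulNr oppr_le0 divr_ge0// sqr_ge0.
Qed.

Lemma normalized_packet_bounded p q r w w' :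
    1 <= p -> 1 <= q -> 1 <= r -> beurling w -> beurling w' ->
  (forall b, A_space p q r w w' (normalized_packet w b)) /\
  exists M : R, forall b, (A_norm p q r w w' (normalized_packet w b) <= M%:E)%E.
Proof.
move=> p1 q1 r1 bw bw'.
have [B1 h1] := normalized_packet_time_bound p1 bw.
have [B2 h2] := normalized_packet_frequency_bound q1 r1 bw bw'.
split.
  move=> b; split; split.
  - exact: normalized_packet_Lp_loc.
  - by apply: le_lt_trans (h1 b) _; rewrite ltry.
  - exact: fourier_normalized_packet_Lp_loc.
  - by apply: le_lt_trans (h2 b) _; rewrite ltry.
by exists (B1 + B2) => b; rewrite EFinD leeD.
Qed.

Lemma le_sum_amalgam p h (s : seq 'rV[int]_n) : uniq s ->
  (\sum_(a <- s) 'N[leb]_p%:E[EFin \o (h \_ (@unit_cube R n a))] <=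
   amalgam_norm p 1 h)%E.
Proof.
move=> us; rewrite /amalgam_norm invr1 poweRe1; last first.
  by apply: esum_ge0 => *; exact: poweR_ge0.
apply: esum_ge; exists [set` s]; first by split => //; exact: finite_seq.
rewrite -fsbig_seq//; apply: lee_sum => a _.
by rewrite poweRe1// Lnorm_ge0.
Qed.

Lemma le_Lnorm_amalgam p h a :
  ('N[leb]_p%:E[EFin \o (h \_ (@unit_cube R n a))] <= amalgam_norm p 1 h)%E.
Proof. by have := @le_sum_amalgam p h [:: a] isT; rewrite big_seq1. Qed.

(** Infinitely many terms bounded below by [e] would contradict the summability of
the cube norms. *)
Lemma amalgam_small_cube p h (a : nat -> 'rV[int]_n) (e : R) (m : nat) :
  injective a -> 0 < e -> (amalgam_norm p 1 h < +oo)%E ->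
  exists2 k, (m <= k)%N &
    ('N[leb]_p%:E[EFin \o (h \_ (@unit_cube R n (a k)))] < e%:E)%E.
Proof.
move=> ia e0 hoo; apply: contrapT => nex.
have big k : (m <= k)%N ->
    (e%:E <= 'N[leb]_p%:E[EFin \o (h \_ (@unit_cube R n (a k)))])%E.
  by move=> mk; rewrite leNgt; apply/negP => h1; apply: nex; exists k.
have S0 : (0 <= amalgam_norm p 1 h)%E by exact: poweR_ge0.
have Sf : amalgam_norm p 1 h \is a fin_num by rewrite ge0_fin_numE.
pose N := (Num.trunc (fine (amalgam_norm p 1 h) / e)).+1.
have us : uniq (map a (iota m N)) by rewrite map_inj_uniq// iota_uniq.
have := le_sum_amalgam p h us; rewrite leNgt => /negP; apply.
rewrite big_map.
apply: (@lt_le_trans _ _ (\sum_(k <- iota m N) e%:E)%E); last first.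
  rewrite big_seq [leRHS]big_seq; apply: lee_sum => k.
  by rewrite mem_iota => /andP[mk _]; exact: big.
rewrite sumEFin big_const_seq count_predT size_iota iter_addr addr0.
rewrite -(fineK Sf) lte_fin.
rewrite -mulr_natl -ltr_pdivrMr//; exact: truncnS_gt.
Qed.

(** The factor [2^-1 `^ p^-1] accounts for [S] filling only half of the unit cube. *)
Lemma Lnorm_cube_ge p h S (a : 'rV[int]_n) (eta : R) :
  1 <= p -> 0 < eta -> measurable S ->
  S `<=` unit_cube a -> {ae leb, forall x, S x -> eta <= `|h x|} ->
  ((2^-1)%:E <= leb S)%E ->
  ((eta * 2^-1 `^ p^-1)%:E <= 'N[leb]_p%:E[EFin \o (h \_ (unit_cube a))])%E.
Proof.
move=> p1 e0 mS Sa hS S2; have p0 : 0 < p by exact: lt_le_trans p1.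
rewrite unlock.
have -> : (eta * 2^-1 `^ p^-1)%:E = ((eta `^ p * 2^-1)%:E `^ p^-1)%E.
  rewrite poweR_EFin powRM ?powR_ge0// -powRrM mulfV ?gt_eqF// powRr1//.
  exact: ltW.
apply: poweR_le; first by rewrite invr_ge0 ltW.
  by rewrite lee_fin mulr_ge0// powR_ge0.
apply: (@le_trans _ _ ((eta `^ p)%:E * leb S)%E).
  by rewrite EFinM lee_wpmul2l// lee_fin powR_ge0.
apply: ge_lower_integral => //; first exact: powR_ge0.
  by move=> x; exact: poweR_ge0.
apply: filterS hS => x hx Sx; rewrite -poweR_EFin.
apply: poweR_le; [exact: ltW|by rewrite lee_fin ltW|].
by rewrite /= patchE mem_set ?lee_fin ?hx//; exact: Sa.
Qed.

End normalized_packets.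

(** * Lattice cubes that obstruct compactness *)

Section noncompact.
Context {R : realType} {n : nat}.
Local Notation leb := (lebesgue_rV R n).
Local Notation E := 'rV[R]_n.
Implicit Types (f g : E -> R[i]) (w : E -> R) (b : 'rV[int]_n).

Lemma lebesgue_measurable_normcM p g w : Lp_loc p g -> beurling w ->
  lebesgue_measurable (fun x => Normc.normc (g x) * w x).
Proof.
move=> [[u mu uE] [v mv vE] _] [[[k mk kE] _ _] _ _].
exists (fun x => Num.sqrt (u x ^+ 2 + v x ^+ 2) * k x).
  apply: measurable_funM => //.
  apply: (measurableT_comp (continuous_measurable_fun (@sqrt_continuous R))).
  by apply: measurable_funD; exact: measurable_funX.
apply: filterS3 uE vE kE => x /= <- <- <-.
by case: (g x).
Qed.

(** Cut the cube into the part [S] where [|g| w >= eta], up to a null set, and the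
rest, where [|f - g| w >= eta] by the triangle inequality.  One of the two parts has
measure at least one half.  Unlike Minkowski's inequality, which fails for lower
integrals of arbitrary functions, this only involves a superlevel set of [|g| w],
and [|g| w] agrees almost everywhere with a Borel function. *)
Lemma cube_dichotomy p w f g b (eta : R) : 1 <= p -> 0 < eta -> beurling w ->
    lebesgue_measurable (fun x => Normc.normc (g x) * w x) ->
    (forall x, unit_cube b x -> 2 * eta <= Normc.normc (f x) * w x) ->
  let N f := ('N[leb]_p%:E[EFin \o
    ((fun x => Normc.normc (f x) * w x)%R \_ (unit_cube b))])%E in
  let delta := eta * 2^-1 `^ p^-1 in
  (delta%:E <= N (f - g)%R)%E \/ (delta%:E <= N g)%E.
Proof.
move=> p1 e0 bw [k mk gk] hf N delta.
pose Q : set E := unit_cube b.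
have mQ : measurable Q by exact: measurable_unit_cube.
pose S := Q `&` [set x | eta <= k x].
have mS : measurable S.
  apply: measurableI => //; rewrite -[X in measurable X]setTI.
  rewrite (_ : [set x | eta <= k x] = k @^-1` `[eta, +oo[%classic).
    by apply: mk => //; exact: measurable_itv.
  by apply/seteqP; split => x /=; rewrite in_itv/= andbT.
have mQS : measurable (Q `\` S) by exact: measurableD.
have w0 x : 0 <= w x by rewrite ltW// beurling_gt0.
have QE : leb Q = (leb (Q `\` S) + leb S)%E.
  by rewrite (measureDI leb mQ mS) (setIidr (@subIsetl _ Q _)).
have [half|half] := leP (2^-1)%:E (leb S); [right|left].
  apply: Lnorm_cube_ge half => //; first exact: subIsetl.
  by apply: filterS gk => x gx [_ h]; rewrite (le_trans _ (ler_norm _))// gx.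
apply: (@Lnorm_cube_ge _ _ _ _ (Q `\` S)) => //.
- apply: filterS gk => x gx [Qx nSx].
  have gle : Normc.normc (g x) * w x < eta.
    by rewrite gx ltNge; apply/negP => h; apply: nSx.
  apply: le_trans (ler_norm _).
  have := hf x Qx.
  have : Normc.normc (f x) <= Normc.normc ((f - g)%R x) + Normc.normc (g x).
    have -> : f x = (f - g)%R x + g x by rewrite /= !fctE subrK.
    exact: le_normcD.
  move=> /(ler_wpM2r (w0 x)); rewrite mulrDl; lra.
- have S1 : leb S \is a fin_num.
    by rewrite ge0_fin_numE//; apply: lt_le_trans half _; rewrite leey.
  move: QE half; rewrite [leb Q]lebesgue_unit_cube.
  rewrite -(fineK S1); case: (leb (Q `\` S)) => [t| |]//=.
  by move=> /eqP; rewrite -EFinD eqe lte_fin lee_fin => /eqP; lra.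
Qed.

(** On the unit cube at [a] the argument of the Gaussian stays in the unit ball, and
[w' x] is at least [w' a] divided by a bound of [w'] on the unit ball. *)
Lemma packet_cube_lower_bound w w' (e : R) : 0 < e -> beurling w -> beurling w' ->
  exists2 eta : R, 0 < eta & forall b,
    e <= w' (lattice_point b) / w (lattice_point b) ->
    forall x, unit_cube b x ->
    2 * eta <= Normc.normc (normalized_packet w b x) * w' x.
Proof.
move=> e0 bw bw'; have [M M1 wM] := beurling_bounded_near0 bw'.
have M0 : 0 < M by exact: lt_le_trans M1.
pose P : R := normal_peak 1 ^+ n.
have P0 : 0 < P by rewrite exprn_gt0// normal_peak_gt0// oner_neq0.
pose G : R := expR (- 2^-1) ^+ n.
have G0 : 0 < G by rewrite exprn_gt0// expR_gt0.
exists (e * (P * G) / M / 2); first by rewrite !(divr_gt0, mulr_gt0).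
move=> b; set a := lattice_point b => eb x xb.
have wa : 0 < w a := beurling_gt0 a bw.
have wx : 0 < w' x := beurling_gt0 x bw'.
have xa i : -1 <= (x - a) ord0 i <= 1.
  by have := xb i; rewrite !mxE; lra.
have ax : w' a <= w' x * M.
  have [_ _ w'M] := bw'; rewrite -{1}(subrKC x a); apply: le_trans (w'M _ _) _.
  rewrite ler_wpM2l ?(ltW wx)//; apply: wM.
  rewrite -normrN opprB; apply: norm_rV_le => // i.
  by rewrite ler_norml.
rewrite normc_packet ?invr_ge0 ?(ltW wa)// -/a -/P.
have GG : G <= \prod_i expR (- (x - a) ord0 i ^+ 2 / 2).
  rewrite /G -[n in _ ^+ n]card_ord -prodr_const; apply: ler_prod => i _.
  rewrite expR_ge0 ler_expR/=; have := xa i; set z := (x - a) ord0 i.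
  by rewrite expr2; nra.
have ew : e / M <= (w a)^-1 * w' x.
  rewrite ler_pdivrMr//; apply: le_trans eb _.
  by rewrite mulrC -mulrA ler_wpM2l// invr_ge0 ltW.
rewrite (_ : 2 * _ = (e / M) * (P * G)); last by field; rewrite gt_eqF.
rewrite (_ : _ * _ * w' x = (w a)^-1 * w' x *
  (P * \prod_i expR (- (x - a) ord0 i ^+ 2 / 2))); last by ring.
apply: ler_pM => //.
- by rewrite divr_ge0 ?(ltW e0) ?(ltW M0).
- by rewrite mulr_ge0 ?(ltW P0) ?(ltW G0).
by rewrite ler_wpM2l// ltW.
Qed.

(** Rounding [y] down to a lattice point changes both weights by bounded factors
only.  The lattice points are chosen with increasing norms, which makes them
distinct. *)
Lemma far_lattice_points w w' : beurling w -> beurling w' ->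
  ~ (w' y / w y @[y --> at_infinity R n] --> (0 : R)) ->
  exists2 e : R, 0 < e & exists2 a : nat -> 'rV[int]_n, injective a &
    forall k, e <= w' (lattice_point (a k)) / w (lattice_point (a k)).
Proof.
move=> bw bw' ncvg.
have [e e0 far] : exists2 e : R, 0 < e &
    forall M : R, exists2 y : E, M < `|y| & e <= w' y / w y.
  apply: contrapT => nfar; apply: ncvg; apply/cvgr0Pnorm_lt => e e0.
  apply: contrapT => nnear; apply: nfar; exists e => // M.
  apply: contrapT => ny; apply: nnear; exists M => y My.
  rewrite ger0_norm; last by rewrite divr_ge0// ltW// beurling_gt0.
  by rewrite ltNge; apply/negP => ey; apply: ny; exists y.
have [M M1 wM] := beurling_bounded_near0 bw.
have [M' M'1 wM'] := beurling_bounded_near0 bw'.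
have M0 : 0 < M by exact: lt_le_trans M1.
have M'0 : 0 < M' by exact: lt_le_trans M'1.
have lat (r : R) : exists b, r < `|lattice_point b| /\
    e / (M * M') <= w' (lattice_point b) / w (lattice_point b).
  have [y ry ey] := far (r + 1).
  pose b : 'rV[int]_n := \row_i Num.floor (y ord0 i).
  exists b; set a := lattice_point b.
  have ya : `|y - a| <= 1.
    apply: norm_rV_le => // i; rewrite !mxE.
    by have := floor_itv (y ord0 i); rewrite intrD ler_norml; lra.
  split.
    have : `|y| <= `|y - a| + `|a| by rewrite -{1}(subrK a y) ler_normD.
    lra.
  have [_ _ wD] := bw; have [_ _ w'D] := bw'.
  have wa := beurling_gt0 a bw; have wy := beurling_gt0 y bw.
  have w'a : w' y <= w' a * M'.
    rewrite -{1}(subrKC a y); apply: le_trans (w'D _ _) _.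
    by rewrite ler_wpM2l ?wM'// ltW// beurling_gt0.
  have wya : w a <= w y * M.
    rewrite -{1}(subrKC y a); apply: le_trans (wD _ _) _.
    by apply: ler_wpM2l; [exact: ltW|apply: wM; rewrite -normrN opprB].
  rewrite ler_pdivlMr//; apply: (@le_trans _ _ (e / (M * M') * (w y * M))).
    by rewrite ler_wpM2l// divr_ge0 ?mulr_ge0 ?ltW.
  rewrite (_ : _ * _ = e * w y / M'); last by field; rewrite !gt_eqF.
  by rewrite ler_pdivrMr//; apply: le_trans w'a; rewrite -ler_pdivlMr.
have [next nextP] := choice lat.
exists (e / (M * M')); first by rewrite divr_gt0// mulr_gt0.
pose a k := iter k (fun b => next `|lattice_point b|) (next 0).
exists a; last first.
  by case=> [|k]; [exact: (nextP 0).2|exact: (nextP _).2].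
have step k : `|lattice_point (a k)| < `|lattice_point (a k.+1)| :> R.
  exact: (nextP _).1.
have mono i j : (i < j)%N ->
    `|lattice_point (a i)| < `|lattice_point (a j)| :> R.
  elim: j => // j IH; rewrite ltnS leq_eqVlt => /predU1P[->//|/IH h].
  exact: lt_trans h (step j).
by move=> i j aij; case: (ltngtP i j) => // /mono; rewrite aij ltxx.
Qed.

End noncompact.

(** * Non-compactness of the embedding *)

Theorem theorem15 (R : realType) (d : nat) (p q r : R)
    (p1 : 1 <= p) (q1 : 1 <= q) (r1 : 1 <= r)
    (w1 w2 w3 : 'rV[R]_d -> R)
    (b1 : beurling w1) (b2 : beurling w2) (b3 : beurling w3)
    (w31 : weight_prec w3 w1)
    (w31_ncvg0 : ~ (w3 y / w1 y @[y --> at_infinity R d] --> (0 : R))) :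
  ~ compact_operator (A_norm p q r w1 w2) (A_norm p q r w3 w2)
      (A_incl p q r w2 p1 b1 b3 w31).
Proof.
move=> cpt.
have [e e0 [a ia ea]] := far_lattice_points b1 b3 w31_ncvg0.
have [fA [M fM]] := normalized_packet_bounded p1 q1 r1 b1 b2.
pose u k : A_space p q r w1 w2 := SigSub (mem_set (fA (a k))).
have [//|k kmono [g gcvg]] := cpt u; first by exists M => m; exact: fM.
have [eta eta0 etaP] := packet_cube_lower_bound e0 b1 b3.
pose delta := eta * 2^-1 `^ p^-1.
have delta0 : 0 < delta by rewrite mulr_gt0// powR_gt0.
have [[gloc gfin] _] := set_valP g.
have gm := lebesgue_measurable_normcM gloc b3.
have ik : injective (a \o k).
  apply: inj_comp => // i j kij.
  by case: (ltngtP i j) => // /kmono; rewrite kij ltnn.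
pose dist m := A_norm p q r w3 w2 (normalized_packet w1 (a (k m)) - val g)%R.
have /fine_cvgP[finF /cvgr0Pnorm_lt/(_ _ delta0) smallF] := gcvg.
have [m _ mP] : \forall m \near \oo, (dist m < delta%:E)%E.
  near=> m.
  have dfin : dist m \is a fin_num by near: m; exact: finF.
  have dsmall : `|fine (dist m)| < delta by near: m; exact: smallF.
  by rewrite -(fineK dfin) lte_fin (le_lt_trans (ler_norm _) dsmall).
(* Past the rank m the packets are within delta of g, and one of these packets sits
   on a cube where g itself is smaller than delta. *)
have [l ml gl] := amalgam_small_cube m ik delta0 gfin.
have [fg|] := cube_dichotomy p1 eta0 b3 gm (etaP _ (ea (k l))); last first.
  by rewrite leNgt gl.
have := mP l ml; rewrite ltNge => /negP; apply.
apply: le_trans fg _; apply: le_trans (le_Lnorm_amalgam _ _ _) _.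
by apply: leeDl; exact: poweR_ge0.
Unshelve. all: by end_near. Qed.
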